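(* Let $(\Omega,\mathcal A,\mu)$ be an arbitrary measure space, and let $X$ be a fully symmetric space on $(\Omega,\mathcal A,\mu)$ such that $\mathbf 1\notin X$. If $T\in DS$ and $f\in X$, then the averages $M_n(T)(f)=\frac1n\sum_{k=0}^{n-1}T^k(f)$ converge almost uniformly to some $\widehat f\in X$. In particular, for every $T\in DS$ and every $f\in\mathcal R_\mu$, the averages $M_n(T)(f)$ converge almost uniformly to some $\widehat f\in\mathcal R_\mu$.
   Context: $L^0=L^0(\Omega)$ is the algebra of (classes of) a.e. finite real-valued measurable functions on $\Omega$; $L^p=L^p(\Omega)$, $1\le p\le\infty$, are the real $L^p$-spaces; $\mathbf 1=\chi_\Omega$. $L^0_\mu$ is the set of $f\in L^0$ with $\mu\{|f|>\lambda\}<\infty$ for some $\lambda>0$. For $f\in L^0_\mu$, $f^*(t)=\inf\{\lambda>0:\mu\{|f|>\lambda\}\le t\}$, $t>0$, is its non-increasing rearrangement. Let $\nu$ be Lebesgue measure on $(0,\infty)$. A nonzero linear subspace $X\subset L^0_\nu$ with a Banach norm $\|\cdot\|_X$ is fully symmetric on $((0,\infty),\nu)$ if $f\in X$, $g\in L^0_\nu$ and $\int_0^s g^*(t)\,dt\le\int_0^s f^*(t)\,dt$ for all $s>0$ imply $g\in X$ and $\|g\|_X\le\|f\|_X$. A fully symmetric space on $(\Omega,\mathcal A,\mu)$ is a space $X(\Omega)=\{f\in L^0_\mu: f^*\in X\}$ with norm $\|f\|_{X(\Omega)}=\|f^*\|_X$, where $X$ is a fully symmetric space on $((0,\infty),\nu)$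 (the space generating $X(\Omega)$). $\mathcal R_\mu=\{f\in L^1+L^\infty:\ \mu\{|f|>\lambda\}<\infty\text{ for all }\lambda>0\}$. $T\in DS$ (Dunford-Schwartz operator) means $T:L^1+L^\infty\to L^1+L^\infty$ is linear with $\|T(f)\|_1\le\|f\|_1$ for all $f\in L^1$ and $\|T(f)\|_\infty\le\|f\|_\infty$ for all $f\in L^\infty$. Every such $T$ maps each fully symmetric space on $\Omega$ into itself. A sequence $\{f_n\}\subset L^0$ converges almost uniformly (a.u.) to $f\in L^0$ if for every $\epsilon>0$ there is a measurable $E\subset\Omega$ with $\mu(\Omega\setminus E)\le\epsilon$ and $\|(f-f_n)\chi_E\|_\infty\to0$. *)

(* Defs.v *)
From mathcomp Require Import all_boot all_order all_algebra.
From mathcomp Require Import all_classical all_reals all_analysis.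

Set Implicit Arguments.
Unset Strict Implicit.
Unset Printing Implicit Defensive.

Import Order.TTheory GRing.Theory Num.Theory.
Import numFieldNormedType.Exports.

Local Open Scope classical_set_scope.
Local Open Scope ring_scope.

(* As for the elements of [Lfun], classes of a.e. equal functions are
   represented by everywhere real-valued measurable functions, equality in
   [L^0] being [f = g %[ae mu]].  A "space" of classes is a set of
   representatives saturated for this relation, a norm on it is a function of
   representatives that vanishes exactly on the class of 0, and an operator
   is required to respect the relation. *)

Section function_spaces.
Context (d : measure_display) (Omega : measurableType d) (R : realType).
Variable mu : {measure set Omega -> \bar R}.
Implicit Types (f g h : Omega -> R) (X : set (Omega -> R)).

Definition dist_fun f (l : R) : \bar R := mu [set x | l < `|f x|].

Definition L0mu : set (Omega -> R) :=
  [set f | measurable_fun [set: Omega] f /\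
           exists2 l : R, 0 < l & (dist_fun f l < +oo)%E].

(* For [f] in [L0mu] and [0 < t] the infimum is that of a nonempty set of
   positive reals.  The values for [t <= 0] are meaningless. *)
Definition rearrangement f (t : R) : R :=
  inf [set l : R | 0 < l /\ (dist_fun f l <= t%:E)%E].

Definition L1Linfty : set (Omega -> R) :=
  [set f | exists g h,
    [/\ g \in Lfun mu 1, h \in Lfun mu +oo & f = g \+ h]].

Definition Rmu : set (Omega -> R) :=
  [set f | L1Linfty f /\ forall l : R, 0 < l -> (dist_fun f l < +oo)%E].

Record function_subspace X : Prop := FunctionSubspace {
  fsub_measurable : forall f, X f -> measurable_fun [set: Omega] f ;
  fsub_ae : forall f g, X f -> measurable_fun [set: Omega] g ->
    f = g %[ae mu] -> X g ;
  fsub_0 : X (cst 0) ;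
  fsub_D : forall f g, X f -> X g -> X (f \+ g) ;
  fsub_Z : forall (a : R) f, X f -> X (a \*o f) }.

Record banach_norm X (N : (Omega -> R) -> R) : Prop := BanachNorm {
  bnorm_ge0 : forall f, X f -> 0 <= N f ;
  bnorm_eq0 : forall f, X f -> (N f = 0 <-> f = cst 0 %[ae mu]) ;
  bnormZ : forall (a : R) f, X f -> N (a \*o f) = `|a| * N f ;
  ler_bnormD : forall f g, X f -> X g -> N (f \+ g) <= N f + N g ;
  bnorm_complete : forall u : nat -> Omega -> R, (forall n, X (u n)) ->
    (forall eps : R, 0 < eps -> exists m : nat,
       forall i j : nat, (m <= i)%N -> (m <= j)%N -> N (u i \- u j) < eps) ->
    exists2 f, X f & (fun n => N (f \- u n)) @ \oo --> (0 : R) }.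

Record dunford_schwartz (T : (Omega -> R) -> (Omega -> R)) : Prop :=
  DunfordSchwartz {
  ds_stable : forall f, L1Linfty f -> L1Linfty (T f) ;
  ds_ae : forall f g, L1Linfty f -> L1Linfty g ->
    f = g %[ae mu] -> T f = T g %[ae mu] ;
  ds_linear : forall (a : R) f g, L1Linfty f -> L1Linfty g ->
    T ((a \*o f) \+ g) = (a \*o T f) \+ T g %[ae mu] ;
  ds_L1 : forall f, f \in Lfun mu 1 ->
    ('N[mu]_1[EFin \o T f] <= 'N[mu]_1[EFin \o f])%E ;
  ds_Linfty : forall f, f \in Lfun mu +oo ->
    ('N[mu]_+oo[EFin \o T f] <= 'N[mu]_+oo[EFin \o f])%E }.

Definition cvg_au (u : nat -> Omega -> R) f : Prop :=
  forall eps : R, 0 < eps -> exists E : set Omega,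
    [/\ measurable E, (mu (~` E) <= eps%:E)%E &
        (fun n => 'N[mu]_+oo[EFin \o ((f \- u n) \* \1_E)%R]%E) @ \oo
          --> (0 : \bar R)].

End function_spaces.

(* At [n = 0] this is 0, which does not affect limits. *)
Definition ergodic_average (S : Type) (R : realType)
    (T : (S -> R) -> (S -> R)) (n : nat) (f : S -> R) : S -> R :=
  fun x => n%:R^-1 * \sum_(0 <= k < n) iter k T f x.

(* The half-line [((0, +oo), Lebesgue)] is represented as the real line with
   Lebesgue measure restricted to [`]0, +oo[]: values on the complement are
   negligible. *)
Section half_line.
Context (R : realType).

Definition nu : {measure set (measurableTypeR R) -> \bar R} :=
  mrestr (@lebesgue_measure R)
         (@measurable_itv R `]0, +oo[ : measurable (`]0, +oo[ : set R)).

Record fully_symmetric_half_line (X : set (R -> R)) (N : (R -> R) -> R) :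
    Prop := FullySymmetricHalfLine {
  fs_sub_L0 : X `<=` L0mu nu ;
  fs_subspace : function_subspace nu X ;
  fs_neq0 : exists2 f, X f & ~ (f = cst 0 %[ae nu]) ;
  fs_banach : banach_norm nu X N ;
  fs_major : forall f g : R -> R, X f -> L0mu nu g ->
    (forall s : R, 0 < s ->
      (\int[lebesgue_measure]_(t in `]0%R, s[) (rearrangement nu g t)%:E <=
       \int[lebesgue_measure]_(t in `]0%R, s[) (rearrangement nu f t)%:E)%E) ->
    X g /\ N g <= N f }.

End half_line.

Definition fully_symmetric_space (d : measure_display)
    (Omega : measurableType d) (R : realType)
    (mu : {measure set Omega -> \bar R})
    (X : set (Omega -> R)) (N : (Omega -> R) -> R) : Prop :=
  exists (X0 : set (R -> R)) (N0 : (R -> R) -> R),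
    [/\ fully_symmetric_half_line X0 N0,
        X = [set f | L0mu mu f /\ X0 (rearrangement mu f)] &
        forall f, X f -> N f = N0 (rearrangement mu f)].

(* Main.v *)
(** The excess [(|f| - l)^+] of [f] over the level [l] governs everything.  A
    Dunford-Schwartz operator does not increase its integral; summed over the
    levels this gives the contraction property in L^2, without interpolation.
    Chacon's filling scheme, in which at each point mass is absorbed up to the
    level [alpha] and the rest is moved on by [T], gives the weak type (1,1)
    maximal inequality for [T] itself, so that no linear modulus is needed and
    the measure space may be arbitrary.

    For [f] bounded and integrable, almost minimizers of the L^2 norm in
    [f + (1 - T) h] are almost [T]-invariant by the parallelogram law; the
    maximal inequality turns this into smallness of the oscillation of the
    averages.  A function of [R_mu] is the sum of a bounded integrable function
    and of a function whose averages are uniformly small off a small set, so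
    its averages are almost uniformly Cauchy; by Fatou's lemma the limit has no
    larger excess over any level.

    Finally [\int_0^s f^* = inf_l (l s + \int (|f| - l)^+)], so that the limit is
    majorized by [f] in the sense of Hardy and Littlewood, while [1] not in [X]
    forces [X] to be contained in [R_mu]. *)

Require Import Defs.
From mathcomp Require Import all_boot all_order all_algebra.
From mathcomp Require Import all_classical all_reals all_analysis.
From mathcomp Require Import measurable_realfun ess_sup_inf lra ring.

Set Implicit Arguments.
Unset Strict Implicit.
Unset Printing Implicit Defensive.

Import Order.TTheory GRing.Theory Num.Def Num.Theory.
Import numFieldNormedType.Exports.

Local Open Scope classical_set_scope.
Local Open Scope ring_scope.

(** * Truncation at a level *)

Section truncation.
Context (R : realType).
Implicit Types l t : R.

(** A single almost invariant [g] does not control all averages at once, because the displacements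
    over [k] steps add up. Two functions are therefore used: [g] is fixed with tolerance [delta],
    and for every horizon [N] there is a [g'], still within [delta] of [g] in energy, that [T] moves
    so little that [N] displacements remain small. The maximal inequality applied to [g - g']
    carries the estimate from [g'] over to [g] at a cost that does not depend on [N], and continuity
    of the measure from below removes the horizon. Only infima and finite sums enter, neither a
    limit in L^2 nor an invariant function. Positive levels are essential for the excess: at level 0
    it is the function itself, which need not be integrable for an element of R_mu. Since [T] acts
    on classes, its algebraic identities hold almost everywhere only; each argument gathers the
    countably many it uses into one null set, which is joined to the exceptional set. *)

Definition clip l t : R := Num.max (- l) (Num.min t l).

(** Soft thresholding. Keeping the sign makes [clip] and [excess] a splitting to which a linear
    operator can be applied; only the absolute value is (|t| - l)^+. *)
Definition excess l t : R := t - clip l t.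

Lemma clip_excess l t : clip l t + excess l t = t.
Proof. by rewrite /excess addrC subrK. Qed.

Lemma clipE l t : 0 <= l ->
  clip l t = if t < - l then - l else if l < t then l else t.
Proof.
move=> l0; rewrite /clip /Num.max /Num.min.
by case: (ltP t l) => h; case: (ltP l t) => h'; case: (ltP t (- l)) => h'';
  case: ifPn => h3 //; move: h3; rewrite -?leNgt => h3; lra.
Qed.

Lemma normrE t : `|t| = if t < 0 then - t else t.
Proof. by case: ltP => h; [rewrite ltr0_norm|rewrite ger0_norm]. Qed.

Lemma norm_clip_le l t : 0 <= l -> `|clip l t| <= l.
Proof.
move=> l0; rewrite clipE// normrE.
by case: (ltP t (- l)) => h; case: (ltP l t) => h'; case: ltP => h''; lra.
Qed.

(** Both parts carry the sign of [t], so nothing cancels; this is the mass balance of the filling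
    scheme. *)
Lemma norm_clip_excess l t : 0 <= l -> `|clip l t| + `|excess l t| = `|t|.
Proof.
move=> l0; rewrite /excess clipE//.
case: (ltP t (- l)) => h; [|case: (ltP l t) => h'];
  rewrite !normrE; do 3?[case: ltP => ?]; lra.
Qed.

Lemma norm_excess l t : 0 <= l -> `|excess l t| = Num.max (`|t| - l) 0.
Proof.
move=> l0; rewrite /excess clipE// /Num.max.
case: (ltP t (- l)) => h; [|case: (ltP l t) => h'];
  rewrite !normrE; case: (ltP t 0) => ?; do 3?[case: ltP => ?]; lra.
Qed.

Lemma norm_clip_saturated l t : 0 <= l -> excess l t != 0 -> `|clip l t| = l.
Proof.
move=> l0; rewrite /excess clipE// normrE.
case: (ltP t (- l)) => h; case: (ltP l t) => h' => /eqP k;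
  try case: ltP => h''; lra.
Qed.

End truncation.

(** * The L^1 norm and the space L^1 + L^oo *)

Section mass.
Context (d : measure_display) (Omega : measurableType d) (R : realType).
Variable mu : {measure set Omega -> \bar R}.
Implicit Types (f g h : Omega -> R) (l a c : R).

Lemma measurable_fun_excess l f : measurable_fun [set: Omega] f ->
  measurable_fun [set: Omega] (excess l \o f).
Proof.
move=> mf; apply: measurable_funB => //.
by apply: measurable_maxr => //; exact: measurable_minr.
Qed.

Lemma measurable_fun_clip l f : measurable_fun [set: Omega] f ->
  measurable_fun [set: Omega] (clip l \o f).
Proof.
by move=> mf; apply: measurable_maxr => //; exact: measurable_minr.
Qed.

Lemma measurable_fun_scale a f : measurable_fun [set: Omega] f ->
  measurable_fun [set: Omega] (a \*o f).
Proof. by move=> mf; exact: measurable_funM. Qed.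

Lemma measurable_norm_gt f l : measurable_fun [set: Omega] f ->
  measurable [set x | l < `|f x|].
Proof.
move=> mf; rewrite -[X in measurable X]setTI.
have mn : measurable_fun [set: Omega] (normr \o f) by exact: measurableT_comp.
rewrite (_ : [set x | _] = (normr \o f) @^-1` `]l, +oo[%classic); last first.
  by apply/seteqP; split => x /=; rewrite in_itv/= andbT.
exact: mn.
Qed.

Definition mass f : \bar R := (\int[mu]_x (`|f x|)%:E)%E.

Lemma measurable_norm_EFin f : measurable_fun [set: Omega] f ->
  measurable_fun [set: Omega] (fun x => (`|f x|%R)%:E).
Proof. by move=> mf; apply/measurable_EFinP; exact: measurableT_comp. Qed.

Lemma mass_ge0 f : (0 <= mass f)%E.
Proof. by apply: integral_ge0 => x _; rewrite lee_fin. Qed.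

Lemma le_mass f g : measurable_fun [set: Omega] f ->
  measurable_fun [set: Omega] g ->
  (\forall x \ae mu, `|f x| <= `|g x|) -> (mass f <= mass g)%E.
Proof.
move=> mf mg fg; apply: ae_ge0_le_integral => //.
- exact: measurable_norm_EFin.
- exact: measurable_norm_EFin.
- by apply: filterS fg => x fgx _; rewrite lee_fin.
Qed.

Lemma mass_add f g h : measurable_fun [set: Omega] f ->
  measurable_fun [set: Omega] g ->
  (forall x, `|h x| = `|f x| + `|g x|) -> (mass h = mass f + mass g)%E.
Proof.
move=> mf mg hE; rewrite /mass; under eq_integral do rewrite hE EFinD.
by rewrite ge0_integralD//=; exact: measurable_norm_EFin.
Qed.

Lemma massZ a f : measurable_fun [set: Omega] f ->
  (mass (a \*o f) = `|a|%:E * mass f)%E.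
Proof.
move=> mf; rewrite /mass -ge0_integralZl//.
- by apply: eq_integral => x _; rewrite /= normrM EFinM.
- exact: measurable_norm_EFin.
Qed.

Lemma le_massD f g h : measurable_fun [set: Omega] f ->
  measurable_fun [set: Omega] g -> measurable_fun [set: Omega] h ->
  (\forall x \ae mu, `|h x| <= `|f x| + `|g x|) ->
  (mass h <= mass f + mass g)%E.
Proof.
move=> mf mg mh hfg.
pose k x := `|f x| + `|g x|.
have mk : measurable_fun [set: Omega] k.
  by apply: measurable_funD; exact: measurableT_comp.
have kE x : `|k x| = `|f x| + `|g x| by rewrite ger0_norm// addr_ge0.
rewrite -(@mass_add f g k)//; apply: le_mass => //.
by apply: filterS hfg => x; rewrite kE.
Qed.

Lemma le_mass_sum (n : nat) (F : nat -> Omega -> R) h :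
  (forall k, measurable_fun [set: Omega] (F k)) ->
  measurable_fun [set: Omega] h ->
  (\forall x \ae mu, `|h x| <= \sum_(0 <= k < n) `|F k x|) ->
  (mass h <= \sum_(0 <= k < n) mass (F k))%E.
Proof.
move=> mF mh hF; rewrite /mass -ge0_integral_sum//; last first.
  by move=> k; exact: measurable_norm_EFin.
apply: ae_ge0_le_integral => //.
- exact: measurable_norm_EFin.
- by move=> x _; apply: sume_ge0 => k _; rewrite lee_fin.
- by apply: emeasurable_sum => k; exact: measurable_norm_EFin.
- by apply: filterS hF => x fgx _; rewrite sumEFin lee_fin.
Qed.

Lemma mass_sum (n : nat) (F : nat -> Omega -> R) :
  (forall k, measurable_fun [set: Omega] (F k)) ->
  (mass (fun x => \sum_(0 <= k < n) `|F k x|)%R =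
   \sum_(0 <= k < n) mass (F k))%E.
Proof.
move=> mF; rewrite /mass -ge0_integral_sum//; last first.
  by move=> k; exact: measurable_norm_EFin.
apply: eq_integral => x _; rewrite sumEFin ger0_norm//.
by apply: sumr_ge0.
Qed.

Lemma le_measure_bigcup (F : nat -> set Omega) (c : \bar R) :
  (forall n, measurable (F n)) -> nondecreasing_seq F ->
  (forall n, (mu (F n) <= c)%E) -> (mu (\bigcup_n F n) <= c)%E.
Proof.
move=> mF ndF Fc.
have muF : mu (F n) @[n --> \oo] --> mu (\bigcup_n F n).
  by apply: nondecreasing_cvg_mu => //; exact: bigcupT_measurable.
rewrite -(cvg_lim (@ereal_hausdorff R) muF).
by apply: lime_le; [exact: cvgP muF|exact: nearW].
Qed.

Lemma integrable_massP f :
  mu.-integrable [set: Omega] (EFin \o f) <->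
  measurable_fun [set: Omega] f /\ (mass f < +oo)%E.
Proof.
split=> [/integrableP[/measurable_EFinP mf fi]//|[mf fi]].
by apply/integrableP; split => //; exact/measurable_EFinP.
Qed.

Lemma mass_markov a f (E : set Omega) : measurable_fun [set: Omega] f ->
  measurable E -> 0 <= a -> (forall x, E x -> a <= `|f x|) ->
  (a%:E * mu E <= mass f)%E.
Proof.
move=> mf mE a0 Ef.
apply: (@le_trans _ _ (\int[mu]_(x in E) (`|f x|)%:E)%E).
  rewrite -integral_cst//; apply: ge0_le_integral => //.
  by apply: measurable_funTS; exact: measurable_norm_EFin.
by apply: ge0_subset_integral => //; exact: measurable_norm_EFin.
Qed.

Lemma Lnorm_infty_leP f c : measurable_fun [set: Omega] f -> 0 <= c ->
  ('N[mu]_+oo[EFin \o f] <= c%:E)%E <-> (\forall x \ae mu, `|f x| <= c).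
Proof.
move=> mf c0; rewrite unlock /=; case: ifPn => [mu0|].
  split=> [/ess_supP|fc]; first by apply: filterS => x; rewrite lee_fin.
  by apply/ess_supP; apply: filterS fc => x; rewrite lee_fin.
(* For the zero measure the norm is 0 by convention and every property holds almost everywhere. *)
rewrite -leNgt measure_le0 => /eqP mu0.
by split => // _; exact: measure0_ae.
Qed.

Lemma Lfun1_massP f : f \in Lfun mu 1 <->
  measurable_fun [set: Omega] f /\ (mass f < +oo)%E.
Proof. by rewrite Lfun1_integrable integrable_massP. Qed.

Lemma Lfun_inftyP f : f \in Lfun mu +oo <->
  measurable_fun [set: Omega] f /\
  exists2 c, 0 <= c & \forall x \ae mu, `|f x| <= c.
Proof.
split=> [|[mf [c c0 fc]]].
  rewrite inE => /andP[/[!inE]/= mf fi]; split => //.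
  move: fi; rewrite /finite_norm => fi.
  have N0 := Lnorm_ge0 mu +oo%E (EFin \o f).
  exists (fine 'N[mu]_+oo[EFin \o f]); first exact: fine_ge0.
  by apply/Lnorm_infty_leP => //; [exact: fine_ge0|rewrite fineK// ge0_fin_numE].
rewrite inE; apply/andP; split; rewrite inE//= /finite_norm.
by apply: (@le_lt_trans _ _ c%:E); [exact/Lnorm_infty_leP|rewrite ltry].
Qed.

Definition decomp f g h := [/\ measurable_fun [set: Omega] g,
  (mass g < +oo)%E, measurable_fun [set: Omega] h,
  (exists2 c, 0 <= c & \forall x \ae mu, `|h x| <= c) & f = g \+ h].

Lemma L1LinftyP f : L1Linfty mu f <-> exists g h, decomp f g h.
Proof.
split=> [[g [h [/Lfun1_massP[mg gi] /Lfun_inftyP[mh hi] fE]]]|].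
  by exists g, h.
case=> g [h [mg gi mh hi fE]]; exists g, h; split => //.
  exact/Lfun1_massP.
exact/Lfun_inftyP.
Qed.

Lemma L1Linfty_measurable f : L1Linfty mu f -> measurable_fun [set: Omega] f.
Proof.
by move=> /L1LinftyP[g [h [mg _ mh _ ->]]]; exact: measurable_funD.
Qed.

Lemma L1Linfty_integrable f : measurable_fun [set: Omega] f ->
  (mass f < +oo)%E -> L1Linfty mu f.
Proof.
move=> mf fi; apply/L1LinftyP; exists f, (cst 0); split => //.
  by exists 0 => //; apply: aeW => x; rewrite normr0.
by apply/funext => x /=; rewrite addr0.
Qed.

Lemma mass0 : mass (cst 0) = 0%E.
Proof. by rewrite /mass; under eq_integral do rewrite normr0; exact: integral0. Qed.

Lemma L1Linfty_bounded f c : measurable_fun [set: Omega] f ->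
  (\forall x \ae mu, `|f x| <= c) -> L1Linfty mu f.
Proof.
move=> mf fc; apply/L1LinftyP; exists (cst 0), f; split => //.
- by rewrite mass0.
- exists `|c| => //.
  by apply: filterS fc => x /le_trans; apply; exact: ler_norm.
- by apply/funext => x /=; rewrite add0r.
Qed.

Lemma L1LinftyD f g : L1Linfty mu f -> L1Linfty mu g -> L1Linfty mu (f \+ g).
Proof.
move=> /L1LinftyP[f1 [f2 [mf1 if1 mf2 [c c0 fc] ->]]].
move=> /L1LinftyP[g1 [g2 [mg1 ig1 mg2 [c' c'0 gc] ->]]].
apply/L1LinftyP; exists (f1 \+ g1), (f2 \+ g2); split => //.
- exact: measurable_funD.
- apply: (@le_lt_trans _ _ (mass f1 + mass g1)%E); last exact: lte_add_pinfty.
  apply: le_massD => //; first exact: measurable_funD.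
  by apply: aeW => x; exact: ler_normD.
- exact: measurable_funD.
- exists (c + c'); first exact: addr_ge0.
  apply: filterS2 fc gc => x fx gx.
  by rewrite (le_trans (ler_normD _ _))// lerD.
- by apply/funext => x /=; rewrite addrACA.
Qed.

Lemma L1LinftyZ a f : L1Linfty mu f -> L1Linfty mu (a \*o f).
Proof.
move=> /L1LinftyP[f1 [f2 [mf1 if1 mf2 [c c0 fc] ->]]].
apply/L1LinftyP; exists (a \*o f1), (a \*o f2); split => //.
- exact: measurable_fun_scale.
- by rewrite massZ// lte_mul_pinfty.
- exact: measurable_fun_scale.
- exists (`|a| * c); first exact: mulr_ge0.
  by apply: filterS fc => x fx; rewrite /= normrM ler_wpM2l.
- by apply/funext => x /=; rewrite mulrDr.
Qed.

Lemma L1Linfty0 : L1Linfty mu (cst 0).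
Proof. by apply: L1Linfty_integrable; rewrite ?mass0. Qed.

Lemma L1LinftyB f g : L1Linfty mu f -> L1Linfty mu g -> L1Linfty mu (f \- g).
Proof.
move=> Lf Lg; have -> : f \- g = f \+ (-1 \*o g).
  by apply/funext => x /=; rewrite mulN1r.
by apply: L1LinftyD => //; exact: L1LinftyZ.
Qed.

Lemma L1Linfty_sum n (F : nat -> Omega -> R) :
  (forall k, L1Linfty mu (F k)) ->
  L1Linfty mu (fun x => \sum_(0 <= k < n) F k x).
Proof.
move=> LF; elim: n => [|n IH].
  by under eq_fun do rewrite big_geq//; exact: L1Linfty0.
by under eq_fun do rewrite big_nat_recr//=; exact: L1LinftyD.
Qed.

(** With [f = g + h], [g] integrable and [|h| <= c], the excess is at most [|g| + c] on [{|f| > l}],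
    a set of finite measure, and 0 elsewhere. *)
Lemma mass_excess_lty f l : Rmu mu f -> 0 < l -> (mass (excess l \o f) < +oo)%E.
Proof.
move=> [/[dup] /L1Linfty_measurable mf /L1LinftyP[g [h [mg gi mh [c c0 hc] fE]]] dl] l0.
have mA := measurable_norm_gt l mf.
pose A := [set x | l < `|f x|].
have mE : measurable_fun [set: Omega] (excess l \o f).
  exact: measurable_fun_excess.
apply: (@le_lt_trans _ _ (mass g + mass (c \*o \1_A))%E).
  apply: le_massD => //; first exact: measurable_fun_scale.
  apply: filterS hc => x hx /=; rewrite (norm_excess _ (ltW l0)).
  case: (ltP l `|f x|) => lf; last first.
    by rewrite max_r ?subr_le0// addr_ge0. 
  rewrite indicE mem_set//= mulr1 (ger0_norm c0) ge_max (addr_ge0 _ c0)// andbT.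
  rewrite lerBlDr (@le_trans _ _ (`|g x| + c))//; last by rewrite lerDl ltW.
  by rewrite fE (le_trans (ler_normD _ _))// lerD2l.
apply: lte_add_pinfty => //; rewrite massZ//; apply: lte_mul_pinfty => //.
rewrite /mass; under eq_integral do rewrite ger0_norm//.
by rewrite integral_indic// setIT; exact: dl.
Qed.

End mass.

(** * Dunford-Schwartz operators *)

Section layers.
Context (R : realType).
Implicit Types s t delta : R.

(** Times [2 * delta], this is the left Riemann sum of s^2 = 2 \int_0^oo (s - l)^+ dl. The integrand
    decreases in [l], so the full sum overestimates, by at most its first term [2 * delta * s]. *)
Let layers delta n s := \sum_(0 <= k < n) Num.max (s - k%:R * delta) 0.

Let layersS delta n s : 0 <= s ->
  layers delta n.+1 s = s + layers delta n (s - delta).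
Proof.
move=> s0; rewrite /layers big_nat_recl//= mul0r subr0 max_l//; congr (_ + _).
by apply: eq_bigr => k _; rewrite -natr1; congr (Num.max _ 0); ring.
Qed.

Let layers_lt0 delta n s : 0 <= delta -> s <= 0 -> layers delta n s = 0.
Proof.
move=> d0 s0; rewrite /layers big1// => k _; rewrite max_r//.
by rewrite subr_le0 (le_trans s0)// mulr_ge0.
Qed.

Let sqr_le_layers delta n s : 0 <= delta -> 0 <= s -> s <= n%:R * delta ->
  s ^+ 2 <= 2 * delta * layers delta n s.
Proof.
move=> d0; elim: n s => [|n IH] s s0.
  by rewrite mul0r => s1; rewrite (_ : s = 0) ?expr0n ?mulr_ge0// ?/layers ?big_geq//; lra.
rewrite -natr1 mulrDl mul1r => sn; rewrite layersS//.
case: (leP s delta) => sd; first by rewrite layers_lt0//; nra.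
by have := IH (s - delta); rewrite !subr_ge0 (ltW sd) => /(_ isT); nra.
Qed.

Let layers_le_sqr delta n s : 0 <= delta -> 0 <= s ->
  2 * delta * layers delta n s <= s ^+ 2 + 2 * delta * s.
Proof.
move=> d0; elim: n s => [|n IH] s s0.
  by rewrite /layers big_geq//; nra.
rewrite layersS//.
case: (leP s delta) => sd; first by rewrite layers_lt0//; nra.
by have := IH (s - delta); rewrite subr_ge0 (ltW sd) => /(_ isT); nra.
Qed.

Let layers_excess delta n t : 0 <= delta ->
  \sum_(0 <= k < n) `|2 * delta * excess (k%:R * delta) t| =
  2 * delta * layers delta n `|t|.
Proof.
move=> d0; rewrite /layers mulr_sumr; apply: eq_bigr => k _.
by rewrite normrM norm_excess ?mulr_ge0// ger0_norm// mulr_ge0.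
Qed.

Lemma sqr_le_sum_excess delta n t : 0 <= delta -> `|t| <= n%:R * delta ->
  t ^+ 2 <= \sum_(0 <= k < n) `|2 * delta * excess (k%:R * delta) t|.
Proof.
by move=> d0 tn; rewrite layers_excess// -(real_normK (num_real t)); exact: sqr_le_layers.
Qed.

Lemma sum_excess_le_sqr delta n t : 0 <= delta ->
  \sum_(0 <= k < n) `|2 * delta * excess (k%:R * delta) t|
    <= t ^+ 2 + 2 * delta * `|t|.
Proof.
by move=> d0; rewrite layers_excess// -(real_normK (num_real t)); exact: layers_le_sqr.
Qed.

End layers.

Section ae.
Context (d : measure_display) (Omega : measurableType d) (R : realType).
Variable mu : {measure set Omega -> \bar R}.

Lemma ae_eqT (f g : Omega -> R) :
  f = g %[ae mu] <-> \forall x \ae mu, f x = g x.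
Proof. by split; apply: filterS => x // /(_ Logic.I). Qed.

End ae.

Section dunford_schwartz.
Context (d : measure_display) (Omega : measurableType d) (R : realType).
Variable mu : {measure set Omega -> \bar R}.
Variable T : (Omega -> R) -> (Omega -> R).
Hypothesis dsT : dunford_schwartz mu T.
Implicit Types (f g h : Omega -> R) (l a c : R).

Lemma ds_measurable f : L1Linfty mu f -> measurable_fun [set: Omega] (T f).
Proof. by move=> Lf; apply: L1Linfty_measurable (ds_stable dsT Lf). Qed.

Lemma ds_mass f : measurable_fun [set: Omega] f -> (mass mu f < +oo)%E ->
  (mass mu (T f) <= mass mu f)%E.
Proof.
move=> mf fi; have /(ds_L1 dsT) : f \in Lfun mu 1 by apply/Lfun1_massP.
by rewrite !Lnorm1.
Qed.

Lemma ds_bound f c : 0 <= c -> measurable_fun [set: Omega] f ->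
  (\forall x \ae mu, `|f x| <= c) -> \forall x \ae mu, `|T f x| <= c.
Proof.
move=> c0 mf fc.
have /(ds_Linfty dsT) : f \in Lfun mu +oo.
  by apply/Lfun_inftyP; split => //; exists c.
have mT : measurable_fun [set: Omega] (T f).
  exact: ds_measurable (L1Linfty_bounded mf fc).
move=> TN; apply/Lnorm_infty_leP => //; apply: le_trans TN _.
exact/Lnorm_infty_leP.
Qed.

Lemma ds_congr f g : L1Linfty mu f -> L1Linfty mu g ->
  (\forall x \ae mu, f x = g x) -> \forall x \ae mu, T f x = T g x.
Proof. by move=> Lf Lg /ae_eqT fg; apply/ae_eqT; exact: ds_ae. Qed.

Lemma ds_add f g : L1Linfty mu f -> L1Linfty mu g ->
  \forall x \ae mu, T (f \+ g) x = T f x + T g x.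
Proof.
move=> Lf Lg; have /ae_eqT := ds_linear dsT 1 Lf Lg.
rewrite (_ : (1 \*o f) = f); last by apply/funext => x /=; rewrite mul1r.
by apply: filterS => x ->; rewrite /= mul1r.
Qed.

Lemma ds_0 : \forall x \ae mu, T (cst 0) x = 0.
Proof.
have : \forall x \ae mu, `|T (cst 0) x| <= 0.
  by apply: ds_bound => //; apply: aeW => x; rewrite normr0.
by apply: filterS => x; rewrite normr_le0 => /eqP.
Qed.

Lemma ds_scale a f : L1Linfty mu f ->
  \forall x \ae mu, T (a \*o f) x = a * T f x.
Proof.
move=> Lf; have /ae_eqT := ds_linear dsT a Lf (L1Linfty0 mu).
rewrite (_ : (a \*o f) \+ cst 0 = a \*o f); last first.
  by apply/funext => x /=; rewrite addr0.
by apply: filterS2 ds_0 => x /= -> ->; rewrite addr0.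
Qed.

Lemma ds_sub f g : L1Linfty mu f -> L1Linfty mu g ->
  \forall x \ae mu, T (f \- g) x = T f x - T g x.
Proof.
move=> Lf Lg; have /ae_eqT := ds_linear dsT (-1) Lg Lf.
rewrite (_ : (-1 \*o g) \+ f = f \- g); last first.
  by apply/funext => x /=; rewrite mulN1r addrC.
by apply: filterS => x ->; rewrite /= mulN1r addrC.
Qed.

Lemma ds_sum n (F : nat -> Omega -> R) : (forall k, L1Linfty mu (F k)) ->
  \forall x \ae mu, T (fun y => \sum_(0 <= k < n) F k y) x =
                    \sum_(0 <= k < n) T (F k) x.
Proof.
move=> LF; elim: n => [|n IH].
  rewrite (_ : (fun y => \sum_(0 <= k < 0) F k y) = cst 0); last first.
    by apply/funext => y; rewrite big_geq.
  by apply: filterS ds_0 => x ->; rewrite big_geq.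
rewrite (_ : (fun y => \sum_(0 <= k < n.+1) F k y) =
    (fun y => \sum_(0 <= k < n) F k y) \+ F n); last first.
  by apply/funext => y; rewrite big_nat_recr.
apply: filterS2 IH (ds_add (L1Linfty_sum n LF) (LF n)) => x IH ->.
by rewrite IH big_nat_recr.
Qed.

Lemma ds_iter k : dunford_schwartz mu (iter k T).
Proof.
elim: k => [|k IH]; first by split => //= *; exact: ae_eq_refl.
split => /=.
- by move=> f Lf; apply: (ds_stable dsT); exact: (ds_stable IH).
- move=> f g Lf Lg fg; apply: (ds_ae dsT); [exact: (ds_stable IH)..|].
  exact: (ds_ae IH).
- move=> a f g Lf Lg; have Lf' := ds_stable IH Lf; have Lg' := ds_stable IH Lg.
  apply: ae_eq_trans (ds_linear dsT a Lf' Lg').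
  apply: (ds_ae dsT); last exact: (ds_linear IH).
  + by apply: (ds_stable IH); apply: L1LinftyD => //; exact: L1LinftyZ.
  + by apply: L1LinftyD => //; exact: L1LinftyZ.
- move=> f fi; have le := ds_L1 IH fi; apply: (le_trans _ le).
  apply: (ds_L1 dsT); move: fi le => /Lfun1_massP[mf fi]; rewrite !Lnorm1 => le.
  apply/Lfun1_massP; split; last exact: le_lt_trans fi.
  apply: L1Linfty_measurable; apply: (ds_stable IH).
  exact: L1Linfty_integrable.
- move=> f fi; have le := ds_Linfty IH fi; apply: (le_trans _ le).
  apply: (ds_Linfty dsT); move: fi le => /[dup] fi /Lfun_inftyP[mf [c c0 fc]] le.
  have mT : measurable_fun [set: Omega] (iter k T f).
    apply: L1Linfty_measurable; apply: (ds_stable IH).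
    exact: L1Linfty_bounded fc.
  apply/Lfun_inftyP; split=> //; exists c => //.
  apply/Lnorm_infty_leP => //; apply: le_trans le _.
  exact/Lnorm_infty_leP.
Qed.

(* [|T f| <= l + |T (excess l f)|], so that [(|T f| - l)^+] is dominated by
   the image of the part of [f] exceeding [l]. *)
Lemma mass_excess_ds f l : 0 <= l -> L1Linfty mu f ->
  (mass mu (excess l \o T f) <= mass mu (excess l \o f))%E.
Proof.
move=> l0 Lf; have mf := L1Linfty_measurable Lf.
have [->|fi] := eqVneq (mass mu (excess l \o f)) +oo%E; first exact: leey.
have {}fi : (mass mu (excess l \o f) < +oo)%E by rewrite ltey.
have mE := measurable_fun_excess l mf.
have mC := measurable_fun_clip l mf.
have Cl : \forall x \ae mu, `|(clip l \o f) x| <= l.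
  by apply: aeW => x; exact: norm_clip_le.
have LE : L1Linfty mu (excess l \o f) by exact: L1Linfty_integrable.
have LC : L1Linfty mu (clip l \o f) by exact: L1Linfty_bounded Cl.
apply: le_trans (ds_mass mE fi).
apply: le_mass.
- by apply: measurable_fun_excess; exact: ds_measurable.
- exact: ds_measurable.
have := ds_add LC LE.
rewrite (_ : (clip l \o f) \+ (excess l \o f) = f); last first.
  by apply/funext => x; exact: clip_excess.
apply: filterS2 (ds_bound l0 mC Cl) => x Tl /= TE.
rewrite norm_excess// ge_max normr_ge0 andbT lerBlDr TE addrC.
by rewrite (le_trans (ler_normD _ _))// lerD2l.
Qed.

Definition energy f := mass mu (fun x => f x ^+ 2).

(** [mass_excess_ds] is summed over the levels [k * delta]. The layer sum exceeds the square by at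
    most [2 * delta * |f|], an integrable error that vanishes with [delta]. *)
Lemma energy_ds f c : measurable_fun [set: Omega] f -> (mass mu f < +oo)%E ->
  0 <= c -> (\forall x \ae mu, `|f x| <= c) -> (energy (T f) <= energy f)%E.
Proof.
move=> mf fi c0 fc; have Lf : L1Linfty mu f by exact: L1Linfty_integrable.
have mT := ds_measurable Lf.
have m2 g : measurable_fun [set: Omega] g ->
    measurable_fun [set: Omega] (fun x => g x ^+ 2).
  by move=> mg; exact: measurable_funX.
have approx delta : 0 < delta ->
    (energy (T f) <= energy f + (2 * delta)%:E * mass mu f)%E.
  move=> d0.
  (* The levels must reach [c], which bounds [|T f|] as well as [|f|]. *)
  have [n nc] : exists n : nat, c <= n%:R * delta.
    exists (truncn (c / delta)).+1; rewrite -ler_pdivrMr//.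
    by rewrite ltW// truncnS_gt// divr_ge0// ltW.
  pose F g k x := 2 * delta * excess (k%:R * delta) (g x).
  have mF g : measurable_fun [set: Omega] g ->
      forall k, measurable_fun [set: Omega] (F g k).
    move=> mg k; apply: (@measurable_fun_scale _ _ _ _ (excess (k%:R * delta) \o g)).
    exact: measurable_fun_excess.
  apply: (@le_trans _ _ (\sum_(0 <= k < n) mass mu (F (T f) k))%E).
    apply: le_mass_sum => //; [exact: mF|exact: m2|].
    apply: filterS (ds_bound c0 mf fc) => x Tx.
    rewrite ger0_norm ?sqr_ge0//; apply: sqr_le_sum_excess; first exact: ltW.
    exact: le_trans nc.
  apply: (@le_trans _ _ (\sum_(0 <= k < n) mass mu (F f k))%E).
    apply: lee_sum => k _.
    rewrite [X in (X <= _)%E](massZ mu (2 * delta) (measurable_fun_excess (k%:R * delta) mT)).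
    rewrite [leRHS](massZ mu (2 * delta) (measurable_fun_excess (k%:R * delta) mf)).
    apply: lee_wpmul2l; first by rewrite lee_fin.
    by apply: mass_excess_ds => //; rewrite mulr_ge0// ltW.
  rewrite -(ger0_norm (_ : 0 <= 2 * delta)); last by rewrite mulr_ge0// ltW.
  rewrite -massZ//.
  pose h x := f x ^+ 2 + 2 * delta * `|f x|.
  have h0 x : 0 <= h x by rewrite addr_ge0 ?sqr_ge0// mulr_ge0// mulr_ge0// ltW.
  rewrite -(@mass_add _ _ _ _ (fun x => f x ^+ 2) ((2 * delta) \*o f) h); last 3 first.
  - exact: m2.
  - exact: measurable_fun_scale.
  - move=> x; rewrite ger0_norm// /h (ger0_norm (sqr_ge0 _))/= normrM.
    by rewrite (@ger0_norm _ (2 * delta))// mulr_ge0// ltW.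
  rewrite -mass_sum//; last exact: mF.
  have mh : measurable_fun [set: Omega] h.
    apply: measurable_funD; first exact: m2.
    by apply: measurable_fun_scale; exact: measurableT_comp.
  apply: le_mass => //.
    apply: measurable_sum => k; apply: measurableT_comp => //; exact: mF.
  apply: aeW => x; rewrite !ger0_norm//; last exact: sumr_ge0.
  by apply: sum_excess_le_sqr; exact: ltW.
apply/lee_addgt0Pr => e e0.
have m0 := mass_ge0 mu f.
have fm : mass mu f \is a fin_num by rewrite ge0_fin_numE.
have fm0 : 0 <= fine (mass mu f) by exact: fine_ge0.
(* This [delta] makes the error at most [e]; the added 1 covers the case of zero mass. *)
apply: le_trans (approx (e / (2 * (fine (mass mu f) + 1))) _) _.
  by rewrite divr_gt0// mulr_gt0// ltr_wpDl.
rewrite leeD2l// -(fineK fm) -EFinM lee_fin.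
set m := fine _ in fm0 *.
have -> : 2 * (e / (2 * (m + 1))) * m = e * (m / (m + 1)).
  by field; rewrite gt_eqF// ltr_wpDl.
by rewrite ler_piMr ?(ltW e0)// ler_pdivrMr ?mul1r ?lerDl// ltr_wpDl.
Qed.

End dunford_schwartz.

(** * The maximal inequality *)

Section maximal_ergodic.
Context (d : measure_display) (Omega : measurableType d) (R : realType).
Variable mu : {measure set Omega -> \bar R}.
Variable T : (Omega -> R) -> (Omega -> R).
Hypothesis dsT : dunford_schwartz mu T.
Implicit Types (f g h : Omega -> R) (a c : R).

Lemma ae_iter_add f g : L1Linfty mu f -> L1Linfty mu g ->
  \forall x \ae mu, forall k, iter k T (f \+ g) x = iter k T f x + iter k T g x.
Proof.
by move=> Lf Lg; apply/ae_foralln => k; exact: ds_add (ds_iter dsT k) _ _ Lf Lg.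
Qed.

Lemma ae_average_add f g : L1Linfty mu f -> L1Linfty mu g ->
  \forall x \ae mu, forall n, ergodic_average T n (f \+ g) x =
    ergodic_average T n f x + ergodic_average T n g x.
Proof.
move=> Lf Lg; apply: filterS (ae_iter_add Lf Lg) => x fg n.
rewrite /ergodic_average -mulrDr -big_split/=; congr (_ * _).
by apply: eq_bigr => k _.
Qed.

Lemma norm_average_le c n f x : 0 <= c -> (forall k, `|iter k T f x| <= c) ->
  `|ergodic_average T n f x| <= c.
Proof.
move=> c0 fc; rewrite /ergodic_average; case: n => [|n].
  by rewrite invr0 mul0r normr0.
rewrite normrM ger0_norm ?invr_ge0// ler_pdivrMl ?ltr0n//.
rewrite (le_trans (ler_norm_sum _ _ _))//.
rewrite (le_trans (ler_sum _ (fun k _ => fc k)))//.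
by rewrite sumr_const_nat subn0 mulr_natl.
Qed.

Lemma ae_average_bound f c : 0 <= c -> measurable_fun [set: Omega] f ->
  (\forall x \ae mu, `|f x| <= c) ->
  \forall x \ae mu, forall n, `|ergodic_average T n f x| <= c.
Proof.
move=> c0 mf fc.
have : \forall x \ae mu, forall k, `|iter k T f x| <= c.
  by apply/ae_foralln => k; exact: ds_bound (ds_iter dsT k) _ _ c0 mf fc.
by apply: filterS => x h n; exact: norm_average_le.
Qed.

Lemma measurable_fun_average n f : L1Linfty mu f ->
  measurable_fun [set: Omega] (ergodic_average T n f).
Proof.
move=> Lf; apply: measurable_funM => //; apply: measurable_sum => k.
exact: ds_measurable (ds_iter dsT k) _ Lf.
Qed.

(** * Chacon's filling scheme *)

Section filling.
Variables (f : Omega -> R) (alpha : R).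
Hypotheses (mf : measurable_fun [set: Omega] f) (fi : (mass mu f < +oo)%E).
Hypothesis alpha_gt0 : 0 < alpha.
Let alpha_ge0 := ltW alpha_gt0.

(* The first component is the mass already absorbed, at most [alpha] at each
   point and frozen once it saturates; the second one is the excess mass still
   to be moved by [T]. *)
Fixpoint filling (n : nat) : (Omega -> R) * (Omega -> R) :=
  if n is m.+1 then
    let y x := (filling m).1 x + T (filling m).2 x in
    let b x := if `|(filling m).1 x| == alpha then (filling m).1 x
               else clip alpha (y x) in
    (b, y \- b)
  else (clip alpha \o f, excess alpha \o f).

Let absorbed n := (filling n).1.
Let moving n := (filling n).2.

(** The total mass cannot grow: at a frozen point all of [T h] moves on, at any other point
    [b + T h] is split without cancellation, and [T] contracts the L^1 norm. By the last clause mass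
    leaves only saturated points. *)
Let fillingP n : [/\ measurable_fun [set: Omega] (absorbed n),
  measurable_fun [set: Omega] (moving n),
  (mass mu (absorbed n) + mass mu (moving n) <= mass mu f)%E,
  forall x, `|absorbed n x| <= alpha &
  forall x, moving n x != 0 -> `|absorbed n x| = alpha].
Proof.
rewrite /absorbed /moving; elim: n => [|n [mb mh bh bl hb]] /=.
  have mC := measurable_fun_clip alpha mf.
  have mE := measurable_fun_excess alpha mf.
  split => //.
  - by rewrite -(@mass_add _ _ _ _ _ _ f)// => x; rewrite norm_clip_excess.
  - by move=> x; exact: norm_clip_le.
  - by move=> x; exact: norm_clip_saturated.
set b := (filling n).1 in mb bh bl hb *.
set h := (filling n).2 in mh bh hb *.
have hi : (mass mu h < +oo)%E.
  by apply: le_lt_trans fi; apply: le_trans bh; rewrite leeDr// mass_ge0.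
have mT : measurable_fun [set: Omega] (T h).
  by apply: ds_measurable dsT _ _; exact: L1Linfty_integrable.
have my : measurable_fun [set: Omega] (b \+ T h) by exact: measurable_funD.
set b' := fun x => if _ then _ else _.
have mb' : measurable_fun [set: Omega] b'.
  apply: measurable_fun_ifT => //; last exact: measurable_fun_clip.
  by apply: measurable_fun_eqr => //; exact: measurableT_comp.
have mh' : measurable_fun [set: Omega] ((b \+ T h) \- b').
  exact: measurable_funB.
split => //.
- pose k x := `|b' x| + `|((b \+ T h) \- b') x|.
  have k0 x : 0 <= k x by rewrite addr_ge0.
  rewrite -(@mass_add _ _ _ _ _ _ k)//; last by move=> x; rewrite ger0_norm.
  apply: le_trans bh.
  apply: (@le_trans _ _ (mass mu b + mass mu (T h))%E); last first.
    by rewrite leeD2l//; exact: ds_mass.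
  apply: le_massD => //.
    by apply: measurable_funD; exact: measurableT_comp.
  apply: aeW => x; rewrite ger0_norm// /k /b' /=.
  case: ifPn => _; first by rewrite addrAC subrr add0r.
  by rewrite norm_clip_excess// ler_normD.
- by move=> x; rewrite /b'; case: ifPn => // _; exact: norm_clip_le.
- move=> x; rewrite /b' /=; case: ifPn => [/eqP//|_].
  exact: norm_clip_saturated.
Qed.

Let saturated n := [set x | `|absorbed n x| = alpha].

Let measurable_saturated n : measurable (saturated n).
Proof.
have [mb _ _ _ _] := fillingP n.
rewrite -[X in measurable X]setTI.
have mna := measurable_fun_eqr
  (measurableT_comp (@normr_measurable R setT) mb) (measurable_cst alpha).
move: mna => /(_ measurableT [set true] _).
rewrite setTI (_ : _ @^-1` _ = saturated n) ?setTI; first exact.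
by apply/seteqP; split => x /= /eqP.
Qed.

(** This is the purpose of freezing: [T] need not be positive, so incoming mass of the opposite sign
    could otherwise undo the saturation. *)
Let saturated_nd : nondecreasing_seq saturated.
Proof.
apply/nondecreasing_seqP => n; apply/subsetPset => x /= xs.
by move: xs; rewrite /saturated /absorbed /= => xs; rewrite xs eqxx.
Qed.

Let mass_saturated n : (alpha%:E * mu (saturated n) <= mass mu f)%E.
Proof.
have [mb mh bh _ _] := fillingP n.
apply: (@le_trans _ _ (mass mu (absorbed n))).
  by apply: mass_markov => // x /= ->.
by apply: le_trans bh; rewrite leeDl// mass_ge0.
Qed.

(** The sum of [T^(n-k) b_k] over [k <= n], with [b_k] the absorbed part: [n + 1] terms, each
    bounded by [alpha] because [T] contracts the sup norm. *)
Fixpoint telescoped (n : nat) : Omega -> R :=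
  if n is m.+1 then absorbed m.+1 \+ T (telescoped m) else absorbed 0.

Let telescopedP n : measurable_fun [set: Omega] (telescoped n) /\
  \forall x \ae mu, `|telescoped n x| <= n.+1%:R * alpha.
Proof.
elim: n => [|n [mt tn]] /=.
  have [mb0 _ _ bl0 _] := fillingP 0%N.
  by split => //; apply: aeW => x; rewrite mul1r.
have [mb1 _ _ bl1 _] := fillingP n.+1.
have nal : 0 <= n.+1%:R * alpha by rewrite mulr_ge0.
split.
  apply: measurable_funD => //; apply: ds_measurable dsT _ _.
  exact: L1Linfty_bounded tn.
apply: filterS (ds_bound dsT nal mt tn) => x tx.
by rewrite (le_trans (ler_normD _ _))// -natr1 mulrDl mul1r addrC lerD.
Qed.

(** Writing [h_j] for the moving part, the balance [T h_j = b_(j+1) - b_j + h_(j+1)] telescopes when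
    [T] is applied to the identity for [n]; the remaining [f - b_0] is [h_0]. *)
Let sum_iterE n : \forall x \ae mu,
  \sum_(0 <= k < n.+1) iter k T f x =
  telescoped n x + \sum_(0 <= j < n.+1) moving j x.
Proof.
have Lmov k : L1Linfty mu (moving k).
  have [_ mh bh _ _] := fillingP k; apply: L1Linfty_integrable => //.
  by apply: le_lt_trans fi; apply: le_trans bh; rewrite leeDr// mass_ge0.
have Ltel k : L1Linfty mu (telescoped k).
  by have [mt tk] := telescopedP k; exact: L1Linfty_bounded tk.
have Lf : L1Linfty mu f by exact: L1Linfty_integrable.
have Lit k : L1Linfty mu (iter k T f) by exact: ds_stable (ds_iter dsT k) _ Lf.
elim: n => [|n IH].
  by apply: aeW => x; rewrite !big_nat1 /= clip_excess.
have LS := L1Linfty_sum n.+1 Lit; have LH := L1Linfty_sum n.+1 Lmov.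
have TS := ds_sum dsT n.+1 Lit.
have TH := ds_sum dsT n.+1 Lmov.
have TA := ds_add dsT (Ltel n) LH.
have TC := ds_congr dsT LS (L1LinftyD (Ltel n) LH) IH.
near=> x.
rewrite big_nat_recl//= -(near TS x)// (near TC x)// (near TA x)// (near TH x)//.
have -> : \sum_(0 <= j < n.+1) T (moving j) x =
    \sum_(0 <= j < n.+1) (absorbed j.+1 x - absorbed j x + moving j.+1 x).
  by apply: eq_bigr => j _; rewrite /absorbed /moving /=; ring.
rewrite big_split/= telescope_sumr// [in RHS]big_nat_recl//.
rewrite -{1}(clip_excess alpha (f x)) /absorbed /moving /=; ring.
Unshelve. all: by end_near. Qed.

(** [E] consists of the points that saturate at some stage. Off [E] no mass ever moves on, so the
    sum of the iterates is the bounded term [telescoped n]; each saturated point holds mass [alpha],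
    which bounds the measure of [E]. *)
Lemma maximal_ergodic_inequality_L1 : exists E : set Omega,
  [/\ measurable E, (alpha%:E * mu E <= mass mu f)%E &
      forall x, ~ E x -> forall n, `|ergodic_average T n f x| <= alpha].
Proof.
have : \forall x \ae mu, forall n, 
    `|telescoped n x| <= n.+1%:R * alpha /\
    \sum_(0 <= k < n.+1) iter k T f x =
      telescoped n x + \sum_(0 <= j < n.+1) moving j x.
  apply/ae_foralln => n; apply: filterS2 (telescopedP n).2 (sum_iterE n).
  by move=> x.
move=> [N [mN N0 HN]].
pose E := \bigcup_n saturated n.
have mE : measurable E by exact: bigcupT_measurable.
exists (E `|` N); split; first exact: measurableU.
  rewrite measureU0//.
  rewrite -lee_pdivlMl//; apply: le_measure_bigcup => // n.
  by rewrite lee_pdivlMl//; exact: mass_saturated.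
move=> x /not_orP[nE nN] [|n].
  by rewrite /ergodic_average invr0 mul0r normr0.
have : forall n, `|telescoped n x| <= n.+1%:R * alpha /\
    \sum_(0 <= k < n.+1) iter k T f x =
      telescoped n x + \sum_(0 <= j < n.+1) moving j x.
  by apply: contrapT => h; apply: nN; exact: HN.
move=> /(_ n)[tn Sn].
rewrite /ergodic_average Sn [X in _ + X]big1 ?addr0; last first.
  move=> j _; apply/eqP; apply: contrapT => /negP hj; apply: nE.
  by exists j => //; have [_ _ _ _] := fillingP j; apply.
by rewrite normrM ger0_norm ?invr_ge0// ler_pdivrMl ?ltr0n.
Qed.

End filling.

(** The clipped part keeps averages bounded by [alpha], and the L^1 inequality treats the excess:
    hence the factor 2. *)
Lemma maximal_ergodic_inequality f alpha : L1Linfty mu f -> 0 < alpha ->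
  exists E : set Omega,
  [/\ measurable E, (alpha%:E * mu E <= mass mu (excess alpha \o f))%E &
      forall x, ~ E x -> forall n, `|ergodic_average T n f x| <= 2 * alpha].
Proof.
move=> Lf a0; have mf := L1Linfty_measurable Lf.
have [->|fi] := eqVneq (mass mu (excess alpha \o f)) +oo%E.
  by exists setT; split; rewrite ?leey// => x /(_ Logic.I).
have {}fi : (mass mu (excess alpha \o f) < +oo)%E by rewrite ltey.
have mE := measurable_fun_excess alpha mf.
have mC := measurable_fun_clip alpha mf.
have Cl : \forall x \ae mu, `|(clip alpha \o f) x| <= alpha.
  by apply: aeW => x; apply: norm_clip_le; exact: ltW.
have [E [measE muE HE]] := maximal_ergodic_inequality_L1 mE fi a0.
have LE : L1Linfty mu (excess alpha \o f) by exact: L1Linfty_integrable.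
have LC : L1Linfty mu (clip alpha \o f) by exact: L1Linfty_bounded Cl.
have := ae_average_add LC LE.
rewrite (_ : (clip alpha \o f) \+ (excess alpha \o f) = f); last first.
  by apply/funext => x; exact: clip_excess.
move=> /(filterS2 _ _ (ae_average_bound (ltW a0) mC Cl)) => /(_ (fun x =>
   forall n, `|ergodic_average T n (clip alpha \o f) x| <= alpha /\
    ergodic_average T n f x = ergodic_average T n (clip alpha \o f) x +
      ergodic_average T n (excess alpha \o f) x)).
case; first by move=> x h1 h2 n.
move=> N [mN N0 HN]; exists (E `|` N); split.
- exact: measurableU.
- by rewrite measureU0.
- move=> x /not_orP[nE nN] n.
  have : forall n, `|ergodic_average T n (clip alpha \o f) x| <= alpha /\
    ergodic_average T n f x = ergodic_average T n (clip alpha \o f) x +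
      ergodic_average T n (excess alpha \o f) x.
    by apply: contrapT => h; apply: nN; exact: HN.
  move=> /(_ n)[h1 ->]; rewrite (le_trans (ler_normD _ _))// mulr2n mulrDl mul1r.
  by rewrite lerD// HE.
Qed.

End maximal_ergodic.

(** * Almost invariant functions in the cohomology class *)

Section au_cauchy.
Context (d : measure_display) (Omega : measurableType d) (R : realType).
Variable mu : {measure set Omega -> \bar R}.

(** One [eps] bounds both the exceptional set and the oscillation off it; [au_cauchy_bad] recovers
    from this a single set that serves for all tolerances. *)
Definition au_cauchy (u : nat -> Omega -> R) : Prop :=
  forall eps : R, 0 < eps -> exists (A : set Omega) (N : nat),
    [/\ measurable A, (mu A <= eps%:E)%E &
        forall x, ~ A x -> forall n m, (N <= n)%N -> (N <= m)%N ->
          `|u n x - u m x| <= eps].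

End au_cauchy.

Section bounded_integrable.
Context (d : measure_display) (Omega : measurableType d) (R : realType).
Variable mu : {measure set Omega -> \bar R}.
Variable T : (Omega -> R) -> (Omega -> R).
Hypothesis dsT : dunford_schwartz mu T.
Implicit Types (f g h : Omega -> R) (a c : R).

Definition bounded_integrable f : Prop :=
  [/\ measurable_fun [set: Omega] f, (mass mu f < +oo)%E &
      exists2 c, 0 <= c & \forall x \ae mu, `|f x| <= c].

Lemma bounded_integrable_L1Linfty f : bounded_integrable f -> L1Linfty mu f.
Proof. by move=> [mf fi _]; exact: L1Linfty_integrable. Qed.

Lemma bounded_integrable0 : bounded_integrable (cst 0).
Proof.
split => //; first by rewrite mass0.
by exists 0 => //; apply: aeW => x; rewrite normr0.
Qed.

Lemma bounded_integrableD f g : bounded_integrable f -> bounded_integrable g ->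
  bounded_integrable (f \+ g).
Proof.
move=> [mf fi [c c0 fc]] [mg gi [c' c'0 gc]]; split.
- exact: measurable_funD.
- apply: (@le_lt_trans _ _ (mass mu f + mass mu g)%E); last exact: lte_add_pinfty.
  apply: le_massD => //; first exact: measurable_funD.
  by apply: aeW => x; exact: ler_normD.
- exists (c + c'); first exact: addr_ge0.
  apply: filterS2 fc gc => x fx gx.
  by rewrite (le_trans (ler_normD _ _))// lerD.
Qed.

Lemma bounded_integrableZ a f : bounded_integrable f ->
  bounded_integrable (a \*o f).
Proof.
move=> [mf fi [c c0 fc]]; split.
- exact: measurable_fun_scale.
- by rewrite massZ// lte_mul_pinfty.
- exists (`|a| * c); first exact: mulr_ge0.
  by apply: filterS fc => x fx; rewrite /= normrM ler_wpM2l.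
Qed.

Lemma bounded_integrable_ds f : bounded_integrable f -> bounded_integrable (T f).
Proof.
move=> /[dup] /bounded_integrable_L1Linfty Lf [mf fi [c c0 fc]]; split.
- exact: ds_measurable dsT _ Lf.
- exact: le_lt_trans (ds_mass dsT mf fi) fi.
- by exists c => //; exact: ds_bound fc.
Qed.

Lemma energy_lty f : bounded_integrable f -> (energy mu f < +oo)%E.
Proof.
move=> [mf fi [c c0 fc]]; apply: (@le_lt_trans _ _ (mass mu (c \*o f))).
  apply: le_mass; [exact: measurable_funX|exact: measurable_fun_scale|].
  apply: filterS fc => x fx /=.
  by rewrite expr2 !normrM ler_wpM2r// (ger0_norm c0).
by rewrite massZ// lte_mul_pinfty.
Qed.

Lemma energy_iter_ds f k : bounded_integrable f ->
  (energy mu (iter k T f) <= energy mu f)%E.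
Proof.
move=> [mf fi [c c0 fc]].
exact: (energy_ds (ds_iter dsT k) mf fi c0 fc).
Qed.

Lemma energy_chebyshev a f : 0 < a -> measurable_fun [set: Omega] f ->
  (mu [set x | (a < `|f x|)%R] <= (a ^- 2)%:E * energy mu f)%E.
Proof.
move=> a0 mf; rewrite -lee_pdivrMl ?invr_gt0 ?exprn_gt0// invrK.
apply: mass_markov.
- exact: measurable_funX.
- exact: measurable_norm_gt.
- by rewrite sqr_ge0.
- by move=> x /= ax; rewrite normrX lerXn2r// ?nnegrE ltW.
Qed.

(** From [a * (s - a) <= s^2]. Combined with the maximal inequality it gives weak type (2,2). *)
Lemma mass_excess_le_energy a f : 0 < a -> measurable_fun [set: Omega] f ->
  (mass mu (excess a \o f) <= (a^-1)%:E * energy mu f)%E.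
Proof.
move=> a0 mf; have ai : 0 <= a^-1 by rewrite invr_ge0 ltW.
rewrite -{1}(ger0_norm ai) -massZ; last exact: measurable_funX.
apply: le_mass.
- exact: measurable_fun_excess.
- by apply: measurable_fun_scale; exact: measurable_funX.
apply: aeW => x; rewrite /= (norm_excess _ (ltW a0)) normrM normrX.
rewrite (ger0_norm ai) mulrC ler_pdivlMr//.
by have := normr_ge0 (f x); rewrite /Num.max; case: ltP => ? ?; nra.
Qed.

Lemma energy_parallelogram f g : measurable_fun [set: Omega] f ->
  measurable_fun [set: Omega] g ->
  (energy mu (f \- g)%R + 4%:E * energy mu (2^-1 \*o (f \+ g))%R =
   2%:E * energy mu f + 2%:E * energy mu g)%E.
Proof.
move=> mf mg.
have n4 : 4 = `|4| :> R by rewrite ger0_norm.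
have n2 : 2 = `|2| :> R by rewrite ger0_norm.
rewrite {1}n4 [in RHS]n2 /energy.
rewrite -!massZ; [|exact: measurable_funX|exact: measurable_funX|]; last first.
  by apply: measurable_funX; apply: measurable_fun_scale; exact: measurable_funD.
pose k x := 2 * f x ^+ 2 + 2 * g x ^+ 2.
have k0 x : 0 <= k x by rewrite addr_ge0// mulr_ge0// sqr_ge0.
rewrite -(@mass_add _ _ _ _ _ _ k); last 3 first.
- by apply: measurable_funX; exact: measurable_funB.
- apply: measurable_fun_scale; apply: measurable_funX; apply: measurable_fun_scale.
  exact: measurable_funD.
- move=> x; rewrite ger0_norm// /k /= (ger0_norm (sqr_ge0 _)).
  by rewrite (ger0_norm (mulr_ge0 (ler0n _ 4) (sqr_ge0 _))); field.
rewrite -(@mass_add _ _ _ _ _ _ k)//.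
- by apply: measurable_fun_scale; exact: measurable_funX.
- by apply: measurable_fun_scale; exact: measurable_funX.
- move=> x; rewrite ger0_norm// /k /=.
  by rewrite !(ger0_norm (mulr_ge0 (ler0n _ 2) (sqr_ge0 _))).
Qed.

(** * Minimizing the energy modulo coboundaries *)

Section cohomologous.
Variable f : Omega -> R.
Hypothesis bf : bounded_integrable f.

(** The transfer function [h] is required to be bounded, so that the averages of [f] and [g] differ
    by O(1/n) uniformly almost everywhere. *)
Definition cohomologous g : Prop := bounded_integrable g /\
  exists2 h, bounded_integrable h & \forall x \ae mu, f x - g x = h x - T h x.

Lemma cohomologous_refl : cohomologous f.
Proof.
split => //; exists (cst 0); first exact: bounded_integrable0.
by apply: filterS (ds_0 dsT) => x ->; rewrite !subrr.
Qed.

(** [f - T g = (f - g) + (g - T g)], so the new transfer function is [h + g]. *)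
Lemma cohomologous_ds g : cohomologous g -> cohomologous (T g).
Proof.
move=> [bg [h bh fg]]; split; first exact: bounded_integrable_ds.
exists (h \+ g); first exact: bounded_integrableD.
have := ds_add dsT (bounded_integrable_L1Linfty bh) (bounded_integrable_L1Linfty bg).
by apply: filterS2 fg => x fg -> /=; rewrite -(subrK (g x) (f x)) fg; ring.
Qed.

Lemma cohomologous_mid g g' : cohomologous g -> cohomologous g' ->
  cohomologous (2^-1 \*o (g \+ g')).
Proof.
move=> [bg [h bh fg]] [bg' [h' bh' fg']].
split; first by apply: bounded_integrableZ; exact: bounded_integrableD.
exists (2^-1 \*o (h \+ h')).
  by apply: bounded_integrableZ; exact: bounded_integrableD.
have Lh := bounded_integrable_L1Linfty bh.
have Lh' := bounded_integrable_L1Linfty bh'.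
have Th := ds_add dsT Lh Lh'.
have T2 := ds_scale dsT 2^-1 (L1LinftyD Lh Lh').
near=> x.
have E1 : f x - g x = h x - T h x by near: x.
have E2 : f x - g' x = h' x - T h' x by near: x.
have -> : T (2^-1 \*o (h \+ h')) x = 2^-1 * (T h x + T h' x).
  by rewrite (near T2 x)//= (near Th x).
rewrite /=; transitivity (2^-1 * ((f x - g x) + (f x - g' x))); first by field.
by rewrite E1 E2; field.
Unshelve. all: by end_near. Qed.

(** The midpoint stays in the class, so its energy is at least [c]; the parallelogram law then
    leaves [2 (c + delta) + 2 (c + delta') - 4 c]. *)
Lemma cohomologousB_energy (c delta delta' : R) g g' :
  (forall k, cohomologous k -> (c%:E <= energy mu k)%E) ->
  cohomologous g -> cohomologous g' ->
  (energy mu g <= (c + delta)%:E)%E -> (energy mu g' <= (c + delta')%:E)%E ->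
  (energy mu (g \- g')%R <= (2 * delta + 2 * delta')%:E)%E.
Proof.
move=> cE cg cg' gd gd'.
have [[mg _ _] _] := cg; have [[mg' _ _] _] := cg'.
have cm := cE _ (cohomologous_mid cg cg').
have := energy_parallelogram mg mg'.
have e0 k : (0 <= energy mu k)%E := mass_ge0 mu _.
have ef k : (energy mu k < +oo)%E -> exists2 r : R, 0 <= r & energy mu k = r%:E.
  move=> kf; exists (fine (energy mu k)); first exact: fine_ge0.
  by rewrite fineK// ge0_fin_numE.
have bm := bounded_integrableD cg.1 cg'.1.
have [r r0 rE] := ef _ (energy_lty cg.1).
have [r' r0' rE'] := ef _ (energy_lty cg'.1).
have [s s0 sE] := ef _ (energy_lty (bounded_integrableZ 2^-1 bm)).
move: gd gd' cm; rewrite rE rE' sE !lee_fin => gd gd' cm.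
have [t t0 ->] : exists2 t : R, 0 <= t & energy mu (g \- g')%R = t%:E.
  apply: ef; rewrite (_ : g \- g' = g \+ (-1 \*o g')).
    apply: energy_lty; apply: bounded_integrableD; first exact: cg.1.
    by apply: bounded_integrableZ; exact: cg'.1.
  by apply/funext => x /=; rewrite mulN1r.
by rewrite -!EFinM -!EFinD => -[] ?; rewrite lee_fin; lra.
Qed.

(* A minimizing sequence for the energy in the affine space
   [f + (1 - T) h] is Cauchy, and its members are asymptotically invariant. *)
Lemma cohomologous_almost_invariant (delta : R) : 0 < delta ->
  exists2 g, cohomologous g & forall delta' : R, 0 < delta' ->
    exists2 g', cohomologous g' &
      (energy mu (g \- g')%R <= delta%:E)%E /\
      (energy mu (g' \- T g')%R <= delta'%:E)%E.
Proof.
move=> d0.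
have e0 k : (0 <= energy mu k)%E := mass_ge0 mu _.
have efin k : cohomologous k -> energy mu k \is a fin_num.
  by move=> [bk _]; rewrite ge0_fin_numE//; exact: energy_lty.
pose S := [set fine (energy mu g) | g in cohomologous].
have hS : has_inf S.
  split; first by exists (fine (energy mu f)); exists f => //; exact: cohomologous_refl.
  by exists 0 => _ [k _ <-]; exact: fine_ge0.
have infE k : cohomologous k -> ((inf S)%:E <= energy mu k)%E.
  move=> ck; rewrite -(fineK (efin _ ck)) lee_fin; apply: ge_inf; first exact: hS.2.
  by exists k.
have adh e : 0 < e -> exists2 k, cohomologous k & (energy mu k <= (inf S + e)%:E)%E.
  move=> e_gt0; have [_ [k ck <-] ke] := inf_adherent e_gt0 hS.
  by exists k => //; rewrite -(fineK (efin _ ck)) lee_fin ltW.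
have [g cg ge] := adh (delta / 4) (divr_gt0 d0 (ltr0n _ 4)).
exists g => // delta' d0'.
have m0 : 0 < Num.min delta delta' / 4 by rewrite divr_gt0// lt_min d0.
have [g' cg' ge'] := adh _ m0.
have md : Num.min delta delta' <= delta by rewrite ge_min lexx.
have md' : Num.min delta delta' <= delta' by rewrite ge_min lexx orbT.
exists g' => //; split.
  by apply: le_trans (cohomologousB_energy infE cg cg' ge ge') _; rewrite lee_fin; lra.
(* [T g'] is cohomologous too and as close to the infimum as [g'], hence close to [g']: this is the
   almost invariance. *)
have geT : (energy mu (T g') <= (inf S + Num.min delta delta' / 4)%:E)%E.
  apply: le_trans ge'.
  exact: (energy_iter_ds 1 cg'.1).
apply: le_trans (cohomologousB_energy infE cg' (cohomologous_ds cg') ge' geT) _.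
by rewrite lee_fin; lra.
Qed.

End cohomologous.
End bounded_integrable.

(** * Oscillation of the averages *)

Section oscillation.
Context (d : measure_display) (Omega : measurableType d) (R : realType).
Variable mu : {measure set Omega -> \bar R}.
Variable T : (Omega -> R) -> (Omega -> R).
Hypothesis dsT : dunford_schwartz mu T.
Implicit Types (f g h : Omega -> R) (a c : R).

Lemma ae_iter_coboundary f g h : L1Linfty mu f -> L1Linfty mu g ->
  L1Linfty mu h -> (\forall x \ae mu, f x - g x = h x - T h x) ->
  \forall x \ae mu, forall k,
    iter k T f x - iter k T g x = iter k T h x - iter k.+1 T h x.
Proof.
move=> Lf Lg Lh fg; apply/ae_foralln => k.
have LT : L1Linfty mu (T h) := ds_stable dsT Lh.
have E1 := ds_sub (ds_iter dsT k) Lf Lg.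
have E2 := ds_sub (ds_iter dsT k) Lh LT.
have E3 := ds_congr (ds_iter dsT k) (L1LinftyB Lf Lg) (L1LinftyB Lh LT) fg.
by apply: filterS3 E1 E2 E3 => x <- E2 ->; rewrite E2 -iterSr.
Qed.

Lemma ae_average_coboundary f g h : L1Linfty mu f -> L1Linfty mu g ->
  L1Linfty mu h -> (\forall x \ae mu, f x - g x = h x - T h x) ->
  \forall x \ae mu, forall n,
    ergodic_average T n f x - ergodic_average T n g x =
    n%:R^-1 * (h x - iter n T h x).
Proof.
move=> Lf Lg Lh /(ae_iter_coboundary Lf Lg Lh); apply: filterS => x fg n.
rewrite /ergodic_average -mulrBr -sumrB; congr (_ * _).
under eq_bigr do rewrite fg -opprB.
by rewrite sumrN telescope_sumr// opprB.
Qed.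

Lemma ae_iter_displacement g : L1Linfty mu g ->
  \forall x \ae mu, forall k,
    g x - iter k T g x = \sum_(0 <= j < k) iter j T (g \- T g) x.
Proof.
move=> Lg; have LT : L1Linfty mu (T g) := ds_stable dsT Lg.
have : \forall x \ae mu, forall k,
    iter k T (g \- T g) x = iter k T g x - iter k T (T g) x.
  by apply/ae_foralln => k; exact: ds_sub (ds_iter dsT k) _ _ Lg LT.
apply: filterS => x gT k; under eq_bigr do rewrite gT -iterSr -opprB.
by rewrite sumrN telescope_sumr// opprB.
Qed.

(** Write [M_n g - g = M_n (g - g') + (M_n g' - g') - (g - g')]. The first term is at most
    [2 * alpha] off [E1] by the maximal inequality, the last at most [alpha] off [E2] by Chebyshev,
    and the middle one at most [alpha] off [E3]. Only [E3] depends on [N], and its measure is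
    governed by [delta']. *)
Let finite_oscillation (g g' : Omega -> R) (alpha delta delta' : R) (N : nat) :
  0 < alpha -> bounded_integrable mu g -> bounded_integrable mu g' ->
  (energy mu (g \- g')%R <= delta%:E)%E ->
  (energy mu (g' \- T g')%R <= delta'%:E)%E ->
  exists E : set Omega, [/\ measurable E,
    (mu E <= (2 * (alpha ^- 2 * delta) +
      N%:R * ((alpha / N.+1%:R) ^- 2 * delta'))%:E)%E &
    forall x, ~ E x -> forall n, (n < N)%N ->
      `|ergodic_average T n.+1 g x - g x| <= 4 * alpha].
Proof.
move=> a0 bg bg' wd wd'.
have Lg := bounded_integrable_L1Linfty bg.
have Lg' := bounded_integrable_L1Linfty bg'.
have Lw := L1LinftyB Lg Lg'.
have LT : L1Linfty mu (T g') := ds_stable dsT Lg'.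
have Lw' := L1LinftyB Lg' LT.
have mw := L1Linfty_measurable Lw.
have [E1 [mE1 muE1 HE1]] := maximal_ergodic_inequality dsT Lw a0.
pose E2 := [set x | alpha < `|(g \- g') x|].
have mE2 : measurable E2 by exact: measurable_norm_gt.
(* Fewer than [N] displacements of size [b] add up to at most [alpha]; [N.+1] keeps the divisor
   positive. *)
pose b := alpha / N.+1%:R.
have b0 : 0 < b by rewrite divr_gt0.
pose W j := [set x | b < `|iter j T (g' \- T g') x|].
pose E3 := \big[setU/set0]_(j < N) W j.
have mI j : measurable_fun [set: Omega] (iter j T (g' \- T g')).
  exact: ds_measurable (ds_iter dsT j) _ Lw'.
have mE3 : measurable E3.
  by apply: bigsetU_measurable => j _; exact/measurable_norm_gt/mI.
have := ae_average_add dsT Lw Lg'.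
rewrite (_ : (g \- g') \+ g' = g); last by apply/funext => x /=; rewrite subrK.
move=> avg; have disp := ae_iter_displacement Lg'.
have [Z [mZ Z0 HZ]] : \forall x \ae mu,
    (forall n, ergodic_average T n g x =
      ergodic_average T n (g \- g') x + ergodic_average T n g' x) /\
    forall k, g' x - iter k T g' x = \sum_(0 <= j < k) iter j T (g' \- T g') x.
  by apply: filterS2 avg disp.
exists (((E1 `|` E2) `|` E3) `|` Z); split.
- by do 3 apply: measurableU => //.
- rewrite measureU0//; last by do 2 apply: measurableU => //.
  have muE1' : (mu E1 <= (alpha ^- 2 * delta)%:E)%E.
    move: muE1; rewrite -lee_pdivlMl// => /le_trans; apply.
    rewrite expr2 invfM -mulrA 2!EFinM; apply: lee_wpmul2l.
      by rewrite lee_fin invr_ge0 ltW.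
    apply: le_trans (mass_excess_le_energy mu a0 mw) _.
    by apply: lee_wpmul2l => //; rewrite lee_fin invr_ge0 ltW.
  have muE2 : (mu E2 <= (alpha ^- 2 * delta)%:E)%E.
    apply: le_trans (energy_chebyshev mu a0 mw) _.
    by rewrite EFinM; apply: lee_wpmul2l => //; rewrite lee_fin invr_ge0 sqr_ge0.
  have muE3 : (mu E3 <= (N%:R * (b ^- 2 * delta'))%:E)%E.
    apply: (le_trans (@Boole_inequality _ _ _ mu W N _)).
      by move=> j _; exact: measurable_norm_gt.
    apply: (@le_trans _ _ (\sum_(j < N) (b ^- 2 * delta')%:E)%E).
      apply: lee_sum => j _; apply: le_trans (energy_chebyshev mu b0 (mI j)) _.
      rewrite EFinM; apply: lee_wpmul2l; first by rewrite lee_fin invr_ge0 sqr_ge0.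
      apply: le_trans wd'; apply: energy_iter_ds dsT _ _ _.
      rewrite (_ : g' \- T g' = g' \+ (-1 \*o T g')); last first.
        by apply/funext => x /=; rewrite mulN1r.
      apply: bounded_integrableD => //; apply: bounded_integrableZ.
      exact: bounded_integrable_ds.
    by rewrite sumEFin sumr_const card_ord mulr_natl.
  apply: le_trans (measureU2 _ _ _) _ => //; first exact: measurableU.
  rewrite EFinD; apply: leeD => //.
  apply: le_trans (measureU2 _ _ _) _ => //.
  by rewrite mulr2n mulrDl mul1r EFinD; exact: leeD.
move=> x /not_orP[/not_orP[/not_orP[nE1 nE2] nE3] nZ] n nN.
have [avgx dispx] : (forall n, ergodic_average T n g x =
      ergodic_average T n (g \- g') x + ergodic_average T n g' x) /\
    forall k, g' x - iter k T g' x = \sum_(0 <= j < k) iter j T (g' \- T g') x.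
  by apply: contrapT => h; apply: nZ; exact: HZ.
have {}nE2 : `|g x - g' x| <= alpha by rewrite leNgt; apply/negP.
have {}nE3 j : (j < N)%N -> `|iter j T (g' \- T g') x| <= b.
  move=> jN; rewrite leNgt; apply/negP => jb; apply: nE3; rewrite /E3 -bigcup_mkord.
  by exists j.
have disp_le k : (k < N)%N -> `|iter k T g' x - g' x| <= alpha.
  move=> kN; rewrite distrC dispx (le_trans (ler_norm_sum _ _ _))//.
  rewrite (@le_trans _ _ (\sum_(0 <= j < k) b))//.
    rewrite big_nat [leRHS]big_nat; apply: ler_sum => j /andP[_ jk]; apply: nE3.
    exact: ltn_trans kN.
  rewrite sumr_const_nat subn0 -mulr_natl /b mulrCA ler_piMr ?(ltW a0)//.
  by rewrite ler_pdivrMr// mul1r ler_nat leqW// ltnW.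
have avg_le : `|ergodic_average T n.+1 g' x - g' x| <= alpha.
  have -> : ergodic_average T n.+1 g' x - g' x =
      n.+1%:R^-1 * \sum_(0 <= k < n.+1) (iter k T g' x - g' x).
    by rewrite sumrB mulrBr sumr_const_nat subn0 -(mulr_natl (g' x)) mulKf//.
  rewrite normrM ger0_norm ?invr_ge0// ler_pdivrMl ?ltr0n//.
  rewrite (le_trans (ler_norm_sum _ _ _))// (@le_trans _ _ (\sum_(0 <= k < n.+1) alpha))//.
    rewrite big_nat [leRHS]big_nat; apply: ler_sum => k /andP[_ kn]; apply: disp_le.
    exact: leq_trans nN.
  by rewrite sumr_const_nat subn0 mulr_natl.
rewrite avgx.
have -> : ergodic_average T n.+1 (g \- g') x + ergodic_average T n.+1 g' x - g x =
  ergodic_average T n.+1 (g \- g') x + ((ergodic_average T n.+1 g' x - g' x) - (g x - g' x)).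
  by ring.
have := HE1 x nE1 n.+1; move: nE2 avg_le; rewrite !ler_norml; lra.
Qed.

(** [g] is chosen before the horizon [N], and [g'] after it, so the sets [F N] have measure at most
    [eta] with the same [g] for all [N], and so has their increasing union. *)
Lemma cohomologous_oscillation f (eta : R) : bounded_integrable mu f ->
  0 < eta -> exists2 g, cohomologous mu T f g & exists A : set Omega,
    [/\ measurable A, (mu A <= eta%:E)%E & forall x, ~ A x -> forall n,
      `|ergodic_average T n.+1 g x - g x| <= eta].
Proof.
move=> bf e0; pose alpha := eta / 4.
have a0 : 0 < alpha by rewrite divr_gt0.
(* [4 * alpha] is [eta]. This [delta] gives [E1] and [E2] together [eta / 2], and [delta'] below
   cancels the factor [N * b^-2] to leave at most [eta / 4] for [E3]. *)
pose delta := alpha ^+ 2 * (eta / 4).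
have d0 : 0 < delta by rewrite mulr_gt0// exprn_gt0.
have [g cg Hg] := cohomologous_almost_invariant dsT bf d0.
exists g => //.
pose D n := [set x | eta < `|ergodic_average T n.+1 g x - g x|].
have Lg := bounded_integrable_L1Linfty cg.1.
have mD n : measurable (D n).
  apply: (@measurable_norm_gt _ _ _ (ergodic_average T n.+1 g \- g)).
  apply: measurable_funB; last exact: L1Linfty_measurable Lg.
  exact: measurable_fun_average dsT _ _ Lg.
pose F N := \bigcup_(n < N) D n.
have mF N : measurable (F N) by exact: bigcup_measurable.
exists (\bigcup_N F N); split.
- exact: bigcupT_measurable.
- apply: le_measure_bigcup => //.
    move=> n m nm; apply/subsetPset; apply: bigcup_subset => k /= kn.
    exact: leq_trans nm.
  move=> N; pose b := alpha / N.+1%:R.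
  have b0 : 0 < b by rewrite divr_gt0.
  pose delta' := b ^+ 2 * (eta / 4 / N.+1%:R).
  have d0' : 0 < delta' by rewrite mulr_gt0 ?exprn_gt0// !divr_gt0.
  have [g' cg' [wd wd']] := Hg _ d0'.
  have [E [mE muE HE]] := finite_oscillation N a0 cg.1 cg'.1 wd wd'.
  apply: (@le_trans _ _ (mu E)).
    apply: le_measure; rewrite ?inE//.
    move=> x [n /= nN]; rewrite /D /= => Dx; apply: contrapT => nE.
    have := HE x nE n nN; rewrite leNgt (_ : 4 * alpha = eta) ?Dx//.
    by rewrite /alpha; field.
  apply: (le_trans muE); rewrite lee_fin /delta /delta' -/b.
  rewrite !mulKf ?gt_eqF ?exprn_gt0//.
  have -> : N%:R * (eta / 4 / N.+1%:R) = eta / 4 * (N%:R / N.+1%:R) by ring.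
  have : (N%:R / N.+1%:R : R) <= 1 by rewrite ler_pdivrMr// mul1r ler_nat.
  move: (N%:R / N.+1%:R) => t t1. nra.
- move=> x nA n; rewrite leNgt; apply/negP => Dx; apply: nA.
  by exists n.+1 => //; exists n => /=.
Qed.

(** The averages are compared with the function [g] itself: those of [f] are eventually near those
    of [g], and these stay near [g] off a small set. *)
Lemma au_cauchy_bounded_integrable f : bounded_integrable mu f ->
  au_cauchy mu (fun n => ergodic_average T n f).
Proof.
move=> bf eps e0; have e4 : 0 < eps / 4 by rewrite divr_gt0.
have [g [bg [h bh fg]] [A [mA muA HA]]] := cohomologous_oscillation bf e4.
have [mh _ [c c0 hc]] := bh.
have : \forall x \ae mu, forall k, `|iter k T h x| <= c.
  by apply/ae_foralln => k; exact: ds_bound (ds_iter dsT k) _ _ c0 mh hc.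
have Lf := bounded_integrable_L1Linfty bf.
have Lg := bounded_integrable_L1Linfty bg.
have Lh := bounded_integrable_L1Linfty bh.
move=> hb; have := ae_average_coboundary Lf Lg Lh fg.
move=> avg; have [Z [mZ Z0 HZ]] : \forall x \ae mu,
    (forall k, `|iter k T h x| <= c) /\
    forall n, ergodic_average T n f x - ergodic_average T n g x =
      n%:R^-1 * (h x - iter n T h x).
  by apply: filterS2 hb avg.
(* From [N] on, the coboundary contributes at most [2 c / n <= eps / 4]. *)
pose N := (truncn (2 * c / (eps / 4))).+1.
have Nc : 2 * c <= N%:R * (eps / 4).
  rewrite -ler_pdivrMr// ltW// truncnS_gt// divr_ge0 ?mulr_ge0// ltW.
exists (A `|` Z), N; split.
- exact: measurableU.
- rewrite measureU0//; apply: (le_trans muA); rewrite lee_fin; lra.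
move=> x /not_orP[nA nZ].
have [hx avgx] : (forall k, `|iter k T h x| <= c) /\
    forall n, ergodic_average T n f x - ergodic_average T n g x =
      n%:R^-1 * (h x - iter n T h x).
  by apply: contrapT => k; apply: nZ; exact: HZ.
have close n : (N <= n)%N -> `|ergodic_average T n f x - g x| <= eps / 2.
  case: n => [//|n] Nn.
  have -> : ergodic_average T n.+1 f x - g x =
    (ergodic_average T n.+1 f x - ergodic_average T n.+1 g x) +
    (ergodic_average T n.+1 g x - g x) by ring.
  have : `|ergodic_average T n.+1 f x - ergodic_average T n.+1 g x| <= eps / 4.
    rewrite avgx normrM ger0_norm ?invr_ge0// ler_pdivrMl ?ltr0n//.
    apply: (@le_trans _ _ (2 * c)).
      rewrite mulr2n mulrDl mul1r (le_trans (ler_normB _ _))//.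
      by apply: lerD; [exact: (hx 0%N)|exact: hx].
    by apply: (le_trans Nc); rewrite ler_pM2r// ler_nat.
  by have := HA x nA n; rewrite !ler_norml; lra.
move=> n m /close + /close; rewrite !ler_norml; lra.
Qed.

(** The excess cut off at height [K] is bounded and integrable. What remains of [f] has excess only
    where [|f| > K], and its mass tends to 0 with growing [K] by dominated convergence. *)
Let middle (alpha : R) f (K : nat) x :=
  if `|f x| <= K%:R then excess alpha (f x) else 0.

Lemma au_cauchy_average f : Rmu mu f ->
  au_cauchy mu (fun n => ergodic_average T n f).
Proof.
(* Two averages of the remainder, each at most [2 * alpha], differ by at most [eps / 2]; the other
   half is for [middle]. *)
move=> rf eps e0; pose alpha := eps / 8.
have a0 : 0 < alpha by rewrite divr_gt0.
have Lf := rf.1; have mf := L1Linfty_measurable Lf.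
have mE := measurable_fun_excess alpha mf.
have Ei := mass_excess_lty rf a0.
have mm K : measurable_fun [set: Omega] (middle alpha f K).
  apply: measurable_fun_ifT => //.
  by apply: measurable_fun_ler => //; exact: measurableT_comp.
have bm K : bounded_integrable mu (middle alpha f K).
  split => //.
    apply: le_lt_trans Ei; apply: le_mass => //.
    by apply: aeW => x; rewrite /middle; case: ifPn => // _; rewrite normr0.
  exists K%:R => //; apply: aeW => x; rewrite /middle.
  case: ifPn => [fK|_]; last by rewrite normr0.
  apply: le_trans fK; rewrite -[leRHS](norm_clip_excess _ (ltW a0)).
  by rewrite lerDr.
pose v K := f \- middle alpha f K.
have Lm K := bounded_integrable_L1Linfty (bm K).
have Lv K : L1Linfty mu (v K) by exact: L1LinftyB.
have mv K := L1Linfty_measurable (Lv K).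
have vE K x : excess alpha (v K x) =
    if `|f x| <= K%:R then 0 else excess alpha (f x).
  rewrite /v /middle /=; case: ifPn => _; last by rewrite subr0.
  have -> : f x - excess alpha (f x) = clip alpha (f x).
    by rewrite -{1}(clip_excess alpha (f x)) addrK.
  apply/eqP; rewrite -normr_eq0 norm_excess ?ltW// max_r// subr_le0.
  exact/norm_clip_le/ltW.
have cvg0 : (fun K => mass mu (excess alpha \o v K)) @ \oo --> (0 : \bar R).
  rewrite -(mass0 mu) /mass.
  apply: (@dominated_cvg _ _ _ mu _ measurableT _ _ (fun x => (`|excess alpha (f x)|)%:E)) => //.
  - by move=> K; apply: measurable_norm_EFin; exact: measurable_fun_excess.
  - move=> x _; apply: cvg_near_cst; near=> K.
    by rewrite /= vE ifT//; near: K; exact: nbhs_infty_ger.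
  - apply/(integrable_massP mu (normr \o (excess alpha \o f))); split.
      exact: measurableT_comp.
    by rewrite /mass; under eq_integral do rewrite /= normr_id.
  - move=> K x _; rewrite lee_fin/= normr_id vE; case: ifPn => // _.
    by rewrite normr0.
have [K HK] : exists K, (mass mu (excess alpha \o v K) <= (alpha * (eps / 2))%:E)%E.
  have : \forall K \near \oo, (mass mu (excess alpha \o v K) < (alpha * (eps / 2))%:E)%E.
    apply: (cvg0 [set y | (y < (alpha * (eps / 2))%:E)%E]).
    apply: open_nbhs_nbhs; split; first exact: open_ereal_lt_ereal.
    by rewrite /= lte_fin mulr_gt0// divr_gt0.
  by move=> [K _ HK]; exists K; apply: ltW; apply: HK => /=.
have [E [measE muE HE]] := maximal_ergodic_inequality dsT (Lv K) a0.
have e2 : 0 < eps / 2 by rewrite divr_gt0.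
have [A [N [mA muA HA]]] := au_cauchy_bounded_integrable (bm K) e2.
have := ae_average_add dsT (Lm K) (Lv K).
rewrite (_ : middle alpha f K \+ v K = f); last first.
  by apply/funext => x /=; rewrite /v /= addrC subrK.
move=> [Z [mZ Z0 HZ]].
exists ((A `|` E) `|` Z), N; split.
- by do 2 apply: measurableU => //.
- rewrite measureU0//; last exact: measurableU.
  apply: le_trans (measureU2 _ _ _) _ => //.
  rewrite (_ : eps%:E = (eps / 2)%:E + (eps / 2)%:E)%E; last first.
    by rewrite -EFinD; congr EFin; field.
  apply: leeD => //; rewrite -(@lee_pmul2l _ alpha%:E)// -EFinM.
  exact: le_trans HK.
move=> x /not_orP[/not_orP[nA nE] nZ] n m Nn Nm.
have avgx : forall n, ergodic_average T n f x =
    ergodic_average T n (middle alpha f K) x + ergodic_average T n (v K) x.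
  by apply: contrapT => k; apply: nZ; exact: HZ.
have := HE x nE n; have := HE x nE m; have := HA x nA n m Nn Nm.
by rewrite !avgx /alpha !ler_norml; lra.
Unshelve. all: by end_near. Qed.

End oscillation.

(** * Almost uniform limits *)

Section almost_uniform_limit.
Context (d : measure_display) (Omega : measurableType d) (R : realType).
Variable mu : {measure set Omega -> \bar R}.

Let cauchy_at (u : nat -> Omega -> R) x := forall e : R, 0 < e ->
  exists N : nat, forall n m, (N <= n)%N -> (N <= m)%N -> `|u n x - u m x| <= e.

(** An upper limit is measurable whether or not the sequence converges. It is the limit at Cauchy
    points; where it is infinite, [fine] returns 0. *)
Let au_limit (u : nat -> Omega -> R) x := fine (limn_esup (fun n => (u n x)%:E)).

Let cauchy_at_cvg u x : cauchy_at u x -> u n x @[n --> \oo] --> au_limit u x.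
Proof.
move=> ux; have cu : cvg (u n x @[n --> \oo]).
  apply/cauchy_cvgP; apply: cauchy_exP => e e0.
  have e2 : 0 < e / 2 by rewrite divr_gt0.
  have [N HN] := ux _ e2; exists (u N x); exists N => // n /= Nn.
  rewrite /ball/=; apply: le_lt_trans (HN _ _ (leqnn N) Nn) _.
  by rewrite ltr_pdivrMr// mulr_natr mulr2n ltrDl.
have /cvg_limn_einf_sup[_ ulim] :
    (u n x)%:E @[n --> \oo] --> (lim (u n x @[n --> \oo]))%:E.
  by apply: cvg_EFin => //; exact: nearW.
by rewrite /au_limit ulim.
Qed.

Let dist_au_limit u x (e : R) N : cauchy_at u x ->
  (forall n m, (N <= n)%N -> (N <= m)%N -> `|u n x - u m x| <= e) ->
  forall n, (N <= n)%N -> `|au_limit u x - u n x| <= e.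
Proof.
move=> /cauchy_at_cvg cu HN n Nn.
have cd : `|u m x - u n x| @[m --> \oo] --> `|au_limit u x - u n x|.
  by apply: cvg_norm; apply: cvgB => //; exact: cvg_cst.
rewrite -(cvg_lim _ cd)//; apply: limr_le; first exact: cvgP cd.
by exists N => // m /= Nm; exact: HN.
Qed.

Let ge0_cvge0 (v : nat -> \bar R) : (forall n, (0 <= v n)%E) ->
  (forall e : R, 0 < e -> exists N : nat, forall n, (N <= n)%N ->
    (v n <= e%:E)%E) -> v @ \oo --> (0 : \bar R).
Proof.
move=> v0 H; apply: cvg_EFin.
  have [N HN] := H 1 ltr01; exists N => // n /= Nn.
  by rewrite ge0_fin_numE// (le_lt_trans (HN n Nn))// ltry.
apply/cvgrPdist_le => e e0; have [N HN] := H e e0; exists N => // n /= Nn.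
rewrite sub0r normrN ger0_norm ?fine_ge0// -lee_fin fineK; first exact: HN.
by rewrite ge0_fin_numE// (le_lt_trans (HN n Nn))// ltry.
Qed.

(** The Cauchy condition is used at the tolerances [eps / 2^(k+1)]; the union of the exceptional
    sets has measure at most [eps] and works for every [e]. *)
Let au_cauchy_bad u (eps : R) : au_cauchy mu u -> 0 < eps ->
  exists A : set Omega, [/\ measurable A, (mu A <= eps%:E)%E &
    forall e : R, 0 < e -> exists N : nat, forall x, ~ A x ->
      forall n m, (N <= n)%N -> (N <= m)%N -> `|u n x - u m x| <= e].
Proof.
move=> cu e0; pose r k : R := eps / (2 ^ k.+1)%:R.
have r0 k : 0 < r k by rewrite divr_gt0// ltr0n expn_gt0.
have /choice[A HA] : forall k, exists A : set Omega, exists N : nat,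
    [/\ measurable A, (mu A <= (r k)%:E)%E &
     forall x, ~ A x -> forall n m, (N <= n)%N -> (N <= m)%N ->
          `|u n x - u m x| <= r k].
  by move=> k; exact: cu.
have mA k : measurable (A k) by have [N []] := HA k.
exists (\bigcup_k A k); split.
- exact: bigcupT_measurable.
- apply: (@le_trans _ _ (\sum_(k <oo) mu (A k))%E).
    by apply: measure_sigma_subadditive => //; exact: bigcupT_measurable.
  apply: le_trans (epsilon_trick0 xpredT (ltW e0)).
  by apply: lee_nneseries => // k _; have [N []] := HA k.
move=> e ep.
have [k ke] : exists k, r k <= e.
  exists (truncn (eps / e)); rewrite /r ler_pdivrMr; last by rewrite ltr0n expn_gt0.
  rewrite mulrC -ler_pdivrMr// ltW//; set t := truncn _.
  apply: (@lt_le_trans _ _ t.+1%:R); first exact: truncnS_gt.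
  by rewrite ler_nat ltnW// ltn_expl.
have [N [_ _ HN]] := HA k; exists N => x nA n m Nn Nm.
by apply: le_trans ke; apply: HN => // Ax; apply: nA; exists k.
Qed.

Lemma au_cauchy_cvg (u : nat -> Omega -> R) :
  (forall n, measurable_fun [set: Omega] (u n)) -> au_cauchy mu u ->
  exists f : Omega -> R, [/\ measurable_fun [set: Omega] f, cvg_au mu u f &
    \forall x \ae mu, u n x @[n --> \oo] --> f x].
Proof.
move=> mu_ cu; exists (au_limit u).
have ml : measurable_fun [set: Omega] (au_limit u).
  apply: (@measurableT_comp _ _ _ _ _ _ (@fine R)) => //.
  by apply: measurable_fun_limn_esup => n; exact/measurable_EFinP.
split => //.
  move=> eps e0; have [A [mA muA HA]] := au_cauchy_bad cu e0.
  exists (~` A); split; [exact: measurableC|by rewrite setCK|].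
  have ca x : ~ A x -> cauchy_at u x.
    by move=> nA e ep; have [N HN] := HA e ep; exists N; exact: HN.
  have mD n : measurable_fun [set: Omega] ((au_limit u \- u n) \* \1_(~` A)).
    by apply: measurable_funM; [exact: measurable_funB|exact: measurable_indic (measurableC mA)].
  apply: ge0_cvge0 => [n|e ep]; first exact: Lnorm_ge0.
  have [N HN] := HA e ep; exists N => n Nn.
  apply/Lnorm_infty_leP => //; first exact: ltW.
  apply: aeW => x; rewrite /= indicE; have [Ax|nA] := pselect (A x).
    by rewrite memNset ?mulr0 ?normr0 ?ltW.
  rewrite mem_set// mulr1; apply: dist_au_limit Nn; first exact: ca.
  exact: HN.
have /choice[A HA] : forall k : nat, exists A : set Omega,
   [/\ measurable A, (mu A <= (k.+1%:R^-1)%:E)%E &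
    forall e : R, 0 < e -> exists N : nat, forall x, ~ A x ->
      forall n m, (N <= n)%N -> (N <= m)%N -> `|u n x - u m x| <= e].
  by move=> k; apply: au_cauchy_bad => //; rewrite invr_gt0.
have mA k : measurable (A k) by have [] := HA k.
(* A point of divergence lies in every [A k], and these have measure at most [1 / (k + 1)]. *)
exists (\bigcap_k A k); split.
- exact: bigcapT_measurable.
- apply/eqP; rewrite -measure_le0; apply/lee_addgt0Pr => e e0; rewrite add0e.
  pose k := truncn e^-1.
  apply: (@le_trans _ _ (mu (A k))).
    apply: le_measure; rewrite ?inE//; first exact: bigcapT_measurable.
    by move=> x; apply.
  have [_ muA _] := HA k; apply: le_trans muA _; rewrite lee_fin.
  by rewrite invf_ple ?posrE// ltW// truncnS_gt.
- move=> x /= nc k _; apply: contrapT => nA; apply: nc; apply: cauchy_at_cvg.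
  have [_ _ H] := HA k; move=> e ep; have [N HN] := H e ep.
  by exists N; exact: HN.
Qed.

End almost_uniform_limit.

(** * Averages and limits in R_mu *)

Section Rmu_averages.
Context (d : measure_display) (Omega : measurableType d) (R : realType).
Variable mu : {measure set Omega -> \bar R}.
Implicit Types f g : Omega -> R.

Lemma dist_fun_excess_lty g (l : R) : measurable_fun [set: Omega] g -> 0 < l ->
  (mass mu (excess l \o g) < +oo)%E -> forall l', l < l' ->
  (dist_fun mu g l' < +oo)%E.
Proof.
move=> mg l0 gi l' ll'.
have mE := measurable_fun_excess l mg.
have h : ((l' - l)%:E * dist_fun mu g l' <= mass mu (excess l \o g))%E.
  apply: mass_markov => //; first exact: measurable_norm_gt.
    by rewrite subr_ge0 ltW.
  move=> x /= lx; rewrite (norm_excess _ (ltW l0)) le_max.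
  by rewrite lerD2r ltW.
rewrite -lee_pdivlMl ?subr_gt0// in h; apply: le_lt_trans h _.
by apply: lte_mul_pinfty => //; rewrite lee_fin invr_ge0 subr_ge0 ltW.
Qed.

Lemma L1Linfty_excess g (l : R) : measurable_fun [set: Omega] g -> 0 <= l ->
  (mass mu (excess l \o g) < +oo)%E -> L1Linfty mu g.
Proof.
move=> mg l0 gi; rewrite (_ : g = (clip l \o g) \+ (excess l \o g)); last first.
  by apply/funext => x /=; rewrite clip_excess.
apply: L1LinftyD.
  apply: (@L1Linfty_bounded _ _ _ _ _ l); first exact: measurable_fun_clip.
  by apply: aeW => x; exact: norm_clip_le.
by apply: L1Linfty_integrable => //; exact: measurable_fun_excess.
Qed.

(** Converse of [mass_excess_lty]: R_mu is described by integrals of excesses, a form that passes to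
    limits by Fatou's lemma. *)
Lemma Rmu_excess g : measurable_fun [set: Omega] g ->
  (forall l : R, 0 < l -> (mass mu (excess l \o g) < +oo)%E) -> Rmu mu g.
Proof.
move=> mg gi; split; first by apply: L1Linfty_excess (gi 1 ltr01).
(* Markov's inequality for the excess controls only strictly higher levels. *)
move=> l l0; have l2 : 0 < l / 2 by rewrite divr_gt0.
apply: dist_fun_excess_lty (gi _ l2) _ _ => //.
by rewrite ltr_pdivrMr// mulr_natr mulr2n ltrDl.
Qed.

Lemma cvg_norm_excess (l t : R) (u : nat -> R) : 0 <= l ->
  u @ \oo --> t -> `|excess l (u n)| @[n --> \oo] --> `|excess l t|.
Proof.
move=> l0 ut; under eq_fun do rewrite norm_excess// maxr_absE.
rewrite norm_excess// maxr_absE.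
have h : `|u n| - l @[n --> \oo] --> `|t| - l.
  by apply: cvgB; [exact: cvg_norm|exact: cvg_cst].
apply: cvgM; last exact: cvg_cst.
apply: cvgD; first by apply: cvgD => //; exact: cvg_cst.
by apply: cvg_norm; apply: cvgB => //; exact: cvg_cst.
Qed.

Variable T : (Omega -> R) -> (Omega -> R).
Hypothesis dsT : dunford_schwartz mu T.

(** The function (|t| - l)^+ is convex, and no iterate increases its integral. *)
Lemma mass_excess_average f (l : R) n : 0 <= l -> L1Linfty mu f ->
  (mass mu (excess l \o ergodic_average T n f) <= mass mu (excess l \o f))%E.
Proof.
move=> l0 Lf; case: n => [|n].
  apply: (@le_trans _ _ 0%E); last exact: mass_ge0.
  rewrite -(mass0 mu) le_eqVlt; apply/orP; left; apply/eqP; congr (mass mu _).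
  apply/funext => x; apply/eqP; rewrite /= -normr_eq0 norm_excess//.
  by rewrite /ergodic_average invr0 mul0r normr0 sub0r max_r// oppr_le0.
have Lk k : L1Linfty mu (iter k T f) := ds_stable (ds_iter dsT k) Lf.
have mE k : measurable_fun [set: Omega] (excess l \o iter k T f).
  exact/measurable_fun_excess/L1Linfty_measurable/Lk.
apply: (@le_trans _ _ (\sum_(0 <= k < n.+1)
    mass mu (n.+1%:R^-1 \*o (excess l \o iter k T f)))%E).
  apply: le_mass_sum.
  - by move=> k; exact: measurable_fun_scale.
  - by apply: measurable_fun_excess; exact: measurable_fun_average dsT _ _ Lf.
  apply: aeW => x /=.
  under eq_bigr do rewrite normrM ger0_norm ?invr_ge0// norm_excess//.
  rewrite norm_excess// ge_max; apply/andP; split; last first.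
    by apply: sumr_ge0 => k _; rewrite mulr_ge0 ?invr_ge0// le_max lexx orbT.
  rewrite lerBlDr -mulr_sumr /ergodic_average normrM ger0_norm ?invr_ge0//.
  rewrite ler_pdivrMl ?ltr0n// mulrDr mulrA divff ?pnatr_eq0// mul1r.
  rewrite (le_trans (ler_norm_sum _ _ _))// mulr_natl.
  rewrite (_ : l *+ n.+1 = \sum_(0 <= k < n.+1) l); last first.
    by rewrite sumr_const_nat subn0.
  rewrite -big_split/=; apply: ler_sum => k _.
  by rewrite -lerBlDr le_max lexx.
apply: (@le_trans _ _ (\sum_(0 <= k < n.+1)
    ((n.+1%:R^-1)%:E * mass mu (excess l \o f)))%E).
  apply: lee_sum => k _; rewrite massZ// ger0_norm ?invr_ge0//.
  by apply: lee_wpmul2l; [rewrite lee_fin invr_ge0|exact: mass_excess_ds (ds_iter dsT k) _ _ _ _].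
rewrite -ge0_sume_distrl; last by move=> k _; rewrite lee_fin invr_ge0.
rewrite sumEFin sumr_const_nat subn0 -(mulr_natl n.+1%:R^-1) divff ?pnatr_eq0// mul1e.
exact: lexx.
Qed.

(** The bound on the excess serves twice: it places [fhat] in R_mu, and it is what
    [le_integral_rearrangement] needs. *)
Lemma Rmu_average_cvg f : Rmu mu f -> exists fhat : Omega -> R,
  [/\ Rmu mu fhat, cvg_au mu (fun n => ergodic_average T n f) fhat &
      forall l : R, 0 < l ->
        (mass mu (excess l \o fhat) <= mass mu (excess l \o f))%E].
Proof.
move=> rf; have Lf := rf.1.
have mM n : measurable_fun [set: Omega] (ergodic_average T n f).
  exact: measurable_fun_average dsT _ _ Lf.
have [fhat [mfh au ae]] := au_cauchy_cvg mM (au_cauchy_average dsT rf).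
have le l : 0 < l -> (mass mu (excess l \o fhat) <= mass mu (excess l \o f))%E.
  move=> l0.
  pose F n x := (`|excess l (ergodic_average T n f x)|)%:E.
  have mF n : measurable_fun [set: Omega] (F n).
    by apply: measurable_norm_EFin; exact: measurable_fun_excess.
  apply: (@le_trans _ _ (\int[mu]_x limn_einf (F^~ x))%E).
    rewrite /mass; apply: ae_ge0_le_integral => //.
    - by apply: measurable_norm_EFin; exact: measurable_fun_excess.
    - move=> x _; rewrite limn_einf_lim; apply: lime_ge; first exact: is_cvg_einfs.
      by apply: nearW => n; apply: le_ereal_inf_tmp => _ [k _ <-]; rewrite lee_fin.
    - rewrite /limn_einf; apply: measurableT_comp => //.
      apply: measurable_fun_limn_esup => n; exact: measurableT_comp.
    apply: filterS ae => x cx _.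
    have : F n x @[n --> \oo] --> (`|excess l (fhat x)|)%:E.
      by apply: cvg_EFin; [exact: nearW|exact: cvg_norm_excess (ltW l0) cx].
    by move=> /cvg_limn_einf_sup[->].
  apply: (le_trans (@fatou _ _ _ mu _ measurableT F mF _)).
    by move=> n x _; rewrite lee_fin.
  rewrite limn_einf_lim; apply: lime_le; first exact: is_cvg_einfs.
  apply: nearW => n; apply: le_trans (mass_excess_average n (ltW l0) Lf).
  by apply: ereal_inf_lbound; exists n => /=.
exists fhat; split => //; apply: Rmu_excess => // l l0.
by apply: le_lt_trans (le l l0) _; exact: mass_excess_lty rf l0.
Qed.

End Rmu_averages.

(** * Comparison of distribution functions *)

Section staircase.
Context (R : realType).
Implicit Types s delta : R.

(** For large [n] this is s^+ rounded up to a multiple of [delta]: a discrete layer-cake formula. *)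
Let stairs delta n s : R := \sum_(0 <= k < n) delta * (k%:R * delta < s)%R%:R.

Let stairsS delta n s : 0 < s ->
  stairs delta n.+1 s = delta + stairs delta n (s - delta).
Proof.
move=> s0; rewrite /stairs big_nat_recl//= mul0r s0 mulr1; congr (_ + _).
by apply: eq_bigr => k _; rewrite ltrBrDr -natr1 mulrDl mul1r.
Qed.

Let stairs_le0 delta n s : 0 <= delta -> s <= 0 -> stairs delta n s = 0.
Proof.
move=> d0 s0; rewrite /stairs big1// => k _; rewrite ltNge (le_trans s0) ?mulr0//.
by rewrite mulr_ge0.
Qed.

Lemma le_staircase delta n s : 0 < delta -> s <= n%:R * delta ->
  Num.max s 0 <= \sum_(0 <= k < n) delta * (k%:R * delta < s)%R%:R.
Proof.
move=> d0; rewrite -/(stairs delta n s); elim: n s => [|n IH] s.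
  by rewrite mul0r => s0; rewrite max_r// stairs_le0// ltW.
rewrite -natr1 mulrDl mul1r => sn; have [s0|s0] := ltP 0 s; last first.
  by rewrite stairs_le0// ltW.
rewrite stairsS//; have := IH (s - delta); rewrite lerBlDr => /(_ sn).
by rewrite ge_max => /andP[+ _]; rewrite lerBlDl.
Qed.

Lemma staircase_le delta n s : 0 < delta ->
  \sum_(0 <= k < n) delta * (k%:R * delta < s)%R%:R <=
  Num.max s 0 + delta * (0 < s)%R%:R.
Proof.
move=> d0; rewrite -/(stairs delta n s); elim: n s => [|n IH] s.
  rewrite /stairs big_geq// addr_ge0//; first by rewrite le_max lexx orbT.
  by rewrite mulr_ge0// ltW.
have [s0|s0] := ltP 0 s; last first.
  by rewrite (stairs_le0 _ (ltW d0) s0) mulr0 addr0.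
rewrite stairsS// mulr1; have := IH (s - delta).
have [sd|sd] := ltP 0 (s - delta); first by rewrite mulr1; lra.
by rewrite mulr0 addr0; lra.
Qed.

End staircase.

Section distribution_comparison.
Context (d1 d2 : measure_display) (T1 : measurableType d1)
  (T2 : measurableType d2) (R : realType).
Variables (mu1 : {measure set T1 -> \bar R}) (mu2 : {measure set T2 -> \bar R}).

Let step (T : Type) (f : T -> R) (l delta : R) k x : R :=
  delta * (k%:R * delta < `|f x| - l)%R%:R.

Let mass_step d (T : measurableType d) (mu : {measure set T -> \bar R})
    (f : T -> R) (l delta : R) k : measurable_fun [set: T] f -> 0 < delta ->
  (\int[mu]_x (step f l delta k x)%:E =
   delta%:E * dist_fun mu f (k%:R * delta + l))%E.
Proof.
move=> mf d0; have mA := measurable_norm_gt (k%:R * delta + l) mf.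
rewrite /dist_fun -[X in (_ * mu X)%E]setIT -integral_indic// -ge0_integralZl//.
- apply: eq_integral => x _; rewrite -EFinM indicE /step ltrBrDr.
  by congr (_ * _)%:E; congr (nat_of_bool _)%:R; apply/idP/idP => [|/set_mem//]; exact: mem_set.
- exact/measurable_EFinP/measurable_indic.
- by rewrite lee_fin ltW.
Qed.

Let measurable_step d (T : measurableType d) (f : T -> R) (l delta : R) k :
  measurable_fun [set: T] f -> measurable_fun [set: T] (step f l delta k).
Proof.
move=> mf; apply: measurable_funM => //.
have mA := measurable_norm_gt (k%:R * delta + l) mf.
rewrite (_ : (fun x => _) = \1_[set x | k%:R * delta + l < `|f x|]).
  exact: measurable_indic.
apply/funext => x; rewrite indicE ltrBrDr.
by congr (nat_of_bool _)%:R; apply/idP/idP => [|/set_mem//]; exact: mem_set.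
Qed.

(* Both sides are compared with the sums [delta * \sum_k mu{|f| > l + k delta}]. *)
Lemma le_mass_excess_dist (f1 : T1 -> R) (f2 : T2 -> R) (l : R) :
  measurable_fun [set: T1] f1 -> measurable_fun [set: T2] f2 -> 0 <= l ->
  (dist_fun mu2 f2 l < +oo)%E ->
  (forall l', l <= l' -> (dist_fun mu1 f1 l' <= dist_fun mu2 f2 l')%E) ->
  (mass mu1 (excess l \o f1) <= mass mu2 (excess l \o f2))%E.
Proof.
move=> mf1 mf2 l0 fin2 le12.
have approx delta : 0 < delta -> (mass mu1 (excess l \o f1) <=
    mass mu2 (excess l \o f2) + delta%:E * dist_fun mu2 f2 l)%E.
  move=> d0.
  have step0 (T : Type) (f : T -> R) k x : (0 <= (step f l delta k x)%:E)%E.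
    by rewrite lee_fin mulr_ge0// ltW.
  apply: (@le_trans _ _ (\int[mu1]_x \sum_(0 <= k <oo) (step f1 l delta k x)%:E)%E).
    apply: ge0_le_integral => //.
    - exact/measurable_norm_EFin/measurable_fun_excess.
    - apply: ge0_emeasurable_sum => // k _; exact/measurable_EFinP/measurable_step.
    (* The number of layers needed depends on [x], since [f1] may be unbounded; hence the infinite
       series. *)
    move=> x _; pose n := (truncn ((`|f1 x| - l) / delta)).+1.
    apply: (@le_trans _ _ (\sum_(0 <= k < n) (step f1 l delta k x)%:E)%E); last first.
      by apply: nneseries_lim_ge => k _ _.
    rewrite sumEFin lee_fin /= norm_excess//; apply: le_staircase => //.
    by rewrite -ler_pdivrMr// ltW// real_truncnS_gt// num_real.
  rewrite integral_nneseries//; last by move=> k; exact/measurable_EFinP/measurable_step.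
  apply: (@le_trans _ _ (\sum_(0 <= k <oo) \int[mu2]_x (step f2 l delta k x)%:E)%E).
    apply: lee_nneseries => [k _ _|k _]; first exact: integral_ge0.
    rewrite !mass_step//; apply: lee_wpmul2l; first by rewrite lee_fin ltW.
    by apply: le12; rewrite lerDr mulr_ge0// ltW.
  rewrite -integral_nneseries//; last by move=> k; exact/measurable_EFinP/measurable_step.
  (* The rounding error, at most [delta] on [{|f2| > l}], is written as the layer [k = 0]. *)
  have -> : dist_fun mu2 f2 l = dist_fun mu2 f2 (0%N%:R * delta + l).
    by rewrite mul0r add0r.
  rewrite -(@mass_step _ _ mu2 f2 l delta 0%N mf2 d0) /mass -ge0_integralD//; last 2 first.
  - exact/measurable_norm_EFin/measurable_fun_excess.
  - exact/measurable_EFinP/measurable_step.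
  apply: ge0_le_integral => //.
  - by move=> x _; exact: nneseries_ge0.
  - apply: ge0_emeasurable_sum => // k _; exact/measurable_EFinP/measurable_step.
  - apply: emeasurable_funD; first exact/measurable_norm_EFin/measurable_fun_excess.
    exact/measurable_EFinP/measurable_step.
  move=> x _; apply: lime_le; first exact: is_cvg_nneseries.
  apply: nearW => n; rewrite sumEFin -EFinD lee_fin /= norm_excess//.
  by apply: le_trans (staircase_le _ _ d0) _; rewrite /step mul0r.
apply/lee_addgt0Pr => e e0.
have d0 : (0 <= dist_fun mu2 f2 l)%E by exact: measure_ge0.
have df : dist_fun mu2 f2 l \is a fin_num by rewrite ge0_fin_numE.
have fd0 : 0 <= fine (dist_fun mu2 f2 l) by exact: fine_ge0.
apply: le_trans (approx (e / (fine (dist_fun mu2 f2 l) + 1)) _) _.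
  by rewrite divr_gt0// ltr_wpDl.
rewrite leeD2l// -(fineK df) -EFinM lee_fin.
set m := fine _ in fd0 *.
by rewrite -mulrA ler_piMr ?(ltW e0)// mulrC ler_pdivrMr ?mul1r ?lerDl// ltr_wpDl.
Qed.

End distribution_comparison.

(** * Non-increasing rearrangements *)

Section rearrangement.
Context (d : measure_display) (Omega : measurableType d) (R : realType).
Variable mu : {measure set Omega -> \bar R}.
Implicit Types (g : Omega -> R) (l s t : R).

Lemma le_dist_fun g l l' : measurable_fun [set: Omega] g -> l <= l' ->
  (dist_fun mu g l' <= dist_fun mu g l)%E.
Proof.
move=> mg ll'; apply: le_measure; rewrite ?inE//; [exact: measurable_norm_gt..|].
by move=> x /=; exact: le_lt_trans.
Qed.

(** Continuity from above along [{|g| > l0 + n}], which starts at a set of finite measure. It makes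
    the infimum defining the rearrangement a genuine one. *)
Lemma L0mu_levels g t : L0mu mu g -> 0 < t ->
  exists l, 0 < l /\ (dist_fun mu g l <= t%:E)%E.
Proof.
move=> [mg [l0 l00 fin0]] t0.
pose F n := [set x | l0 + n%:R < `|g x|].
have mF n : measurable (F n) by exact: measurable_norm_gt.
have F0 : \bigcap_n F n = set0.
  apply/seteqP; split => // x /(_ (truncn `|g x|).+1 Logic.I); rewrite /F /=.
  rewrite ltNge (le_trans (ltW (truncnS_gt _)))// lerDr ltW//.
have cF : mu (F n) @[n --> \oo] --> mu (\bigcap_n F n).
  apply: nonincreasing_cvg_mu => //.
  - by rewrite /F addr0.
  - exact: bigcapT_measurable.
  - apply/nonincreasing_seqP => n; apply/subsetPset => x; rewrite /F /=.
    by apply: le_lt_trans; rewrite lerD2l ler_nat.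
rewrite F0 measure0 in cF.
have [n _ Hn] : \forall n \near \oo, (mu (F n) < t%:E)%E.
  apply: (cF [set y | (y < t%:E)%E]); apply: open_nbhs_nbhs; split.
    exact: open_ereal_lt_ereal.
  by rewrite /= lte_fin.
by exists (l0 + n%:R); split; [rewrite ltr_wpDr|exact: ltW (Hn n (leqnn n))].
Qed.

Let levels_lbound g t : has_lbound [set l | 0 < l /\ (dist_fun mu g l <= t%:E)%E].
Proof. by exists 0 => l /= [/ltW]. Qed.

Lemma rearrangement_ge0 g t : 0 <= rearrangement mu g t.
Proof.
rewrite /rearrangement; set S := [set _ | _].
have [->|/set0P S0] := eqVneq S set0; first by rewrite inf0.
by apply: lb_le_inf => // l /= [/ltW].
Qed.

Lemma rearrangement_lt0 g t : t < 0 -> rearrangement mu g t = 0.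
Proof.
move=> t0; rewrite /rearrangement (_ : [set _ | _] = set0) ?inf0//.
apply/seteqP; split => // l /= [_]; apply/negP; rewrite -ltNge.
by apply: (@lt_le_trans _ _ 0%E); rewrite ?lte_fin// measure_ge0.
Qed.

Lemma rearrangement_le g l t : measurable_fun [set: Omega] g -> 0 <= l ->
  (dist_fun mu g l <= t%:E)%E -> rearrangement mu g t <= l.
Proof.
move=> mg l0 dl; apply/ler_addgt0Pr => e e0; apply: ge_inf; first exact: levels_lbound.
split; first by rewrite ltr_wpDl.
by apply: le_trans dl; apply: le_dist_fun => //; rewrite lerDl ltW.
Qed.

(** The rearrangement is the generalized inverse of the distribution function. The strict inequality
    rests on right continuity: [{|g| > l}] is the increasing union of the sets
    [{|g| > l + 1/(n+1)}]. *)
Lemma lt_rearrangement g l t : L0mu mu g -> 0 <= l -> 0 < t ->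
  (l < rearrangement mu g t) = (t%:E < dist_fun mu g l)%E.
Proof.
move=> Lg l0 t0; have mg := Lg.1; apply/idP/idP; rewrite !ltNge; apply: contra.
  exact: rearrangement_le.
move=> rl.
have hS : has_inf [set k | 0 < k /\ (dist_fun mu g k <= t%:E)%E].
  by split; [exact: L0mu_levels|exact: levels_lbound].
rewrite /dist_fun (_ : [set x | l < `|g x|] =
    \bigcup_n [set x | l + n.+1%:R^-1 < `|g x|]).
  apply: le_measure_bigcup => [n||n]; first exact: measurable_norm_gt.
    apply/nondecreasing_seqP => n; apply/subsetPset => x /=.
    by apply: le_lt_trans; rewrite lerD2l lef_pV2 ?posrE// ler_nat.
  have n0 : (0 : R) < n.+1%:R^-1 by rewrite invr_gt0.
  have [k [k0 dk] kl] := inf_adherent n0 hS.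
  apply: le_trans dk; apply: le_dist_fun => //; apply: (le_trans (ltW kl)).
  by rewrite lerD2r.
apply/seteqP; split => x /=; last first.
  by move=> [n _ /=]; apply: le_lt_trans; rewrite lerDl.
move=> lg; exists (truncn (`|g x| - l)^-1) => //=.
rewrite -ltrBrDl invf_plt ?posrE ?subr_gt0//.
by rewrite truncnS_gt// invr_ge0 subr_ge0 ltW.
Qed.

Lemma rearrangement_nonincreasing g s t : L0mu mu g -> 0 < s -> s <= t ->
  rearrangement mu g t <= rearrangement mu g s.
Proof.
move=> Lg s0 st; have t0 := lt_le_trans s0 st.
rewrite leNgt lt_rearrangement ?rearrangement_ge0// -leNgt.
apply: (@le_trans _ _ s%:E); last by rewrite lee_fin.
by rewrite leNgt -lt_rearrangement ?rearrangement_ge0// ltxx.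
Qed.

(** The superlevel sets are initial intervals of length [dist_fun mu g l], whence
    equimeasurability. *)
Let superlevel g l : L0mu mu g -> 0 <= l ->
  [set t | l < rearrangement mu g t] `&` `]0%R, +oo[ =
  [set t : R | 0 < t /\ (t%:E < dist_fun mu g l)%E].
Proof.
move=> Lg l0; apply/seteqP; split => t /=; rewrite in_itv/= andbT.
  by move=> [lt t0]; split; rewrite -?lt_rearrangement.
by move=> [t0 lt]; rewrite lt_rearrangement.
Qed.

Let initial (c : \bar R) : (0 <= c)%E ->
  measurable [set t : R | 0 < t /\ (t%:E < c)%E] /\
  lebesgue_measure [set t : R | 0 < t /\ (t%:E < c)%E] = c.
Proof.
case: c => [r r0| _|//].
- rewrite (_ : [set _ | _] = `]0%R, r[%classic); last first.
    apply/seteqP; split => t /=; rewrite in_itv/= lte_fin.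
      by move=> [-> ->].
    by move=> /andP[].
  split; first exact: measurable_itv.
  rewrite lebesgue_measure_itv/= lte_fin; case: ltP => r0'; first by rewrite oppr0 adde0.
  by apply/eqP; rewrite eq_le r0 lee_fin.
- rewrite (_ : [set _ | _] = `]0%R, +oo[%classic); last first.
    apply/seteqP; split => t /=; rewrite in_itv/= andbT; first by move=> [].
    by move=> ->; rewrite ltry.
  split; first exact: measurable_itv.
  by rewrite lebesgue_measure_itv/= ltry.
Qed.

Lemma measurable_rearrangement g : L0mu mu g ->
  measurable_fun [set: measurableTypeR R] (rearrangement mu g).
Proof.
move=> Lg mT; apply: (measurability _ (RGenOInfty.measurableE R)) => //.
move=> _ [_ [l ->] <-]; rewrite setTI.
rewrite (_ : _ @^-1` _ = [set t | l < rearrangement mu g t]); last first.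
  by apply/seteqP; split => t /=; rewrite in_itv/= andbT.
have [l0|l0] := ltP l 0.
  rewrite (_ : [set _ | _] = setT)//; apply/seteqP; split => // t _ /=.
  exact: lt_le_trans (rearrangement_ge0 g t).
(* Off the half-line the value is 0 for negative [t] and some convention at 0, so the set is there
   empty or [{0}]. *)
rewrite -[X in measurable X](setIT) -(setUv `]0%R, +oo[%classic) setIUr.
apply: measurableU.
  by rewrite superlevel//; apply: (initial _).1; exact: measure_ge0.
have [r0|r0] := ltP l (rearrangement mu g 0).
  rewrite (_ : _ `&` _ = [set 0]); first exact: measurable_set1.
  apply/seteqP; split => t /=; rewrite in_itv/= andbT.
    move=> [lt /negP]; rewrite -leNgt le_eqVlt => /orP[/eqP//|t0].
    by move: lt; rewrite rearrangement_lt0// ltNge l0.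
  by move=> ->; split => //; rewrite ltxx.
rewrite (_ : _ `&` _ = set0)//; apply/seteqP; split => // t /=.
rewrite in_itv/= andbT => -[lt /negP]; rewrite -leNgt le_eqVlt => /orP[/eqP t0|t0].
  by move: lt; rewrite t0 ltNge r0.
by move: lt; rewrite rearrangement_lt0// ltNge l0.
Qed.

Lemma dist_fun_rearrangement g l : L0mu mu g -> 0 <= l ->
  dist_fun (@nu R) (rearrangement mu g) l = dist_fun mu g l.
Proof.
move=> Lg l0; rewrite {1}/dist_fun /nu /= /mrestr.
rewrite (_ : [set x | l < `|rearrangement mu g x|] =
    [set t | l < rearrangement mu g t]); last first.
  by apply/seteqP; split => t /=; rewrite ger0_norm// rearrangement_ge0.
by rewrite superlevel//; apply: (initial _).2; exact: measure_ge0.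
Qed.

Lemma L0mu_rearrangement g : L0mu mu g -> L0mu (@nu R) (rearrangement mu g).
Proof.
move=> /[dup] Lg [_ [l l0 fin]]; split; first exact: measurable_rearrangement.
by exists l => //; rewrite dist_fun_rearrangement// ltW.
Qed.

(** A rearrangement depends on the distribution function alone. This lets [fs_major], stated for
    functions on the half-line, be applied to rearrangements. *)
Lemma rearrangementK g : L0mu mu g ->
  rearrangement (@nu R) (rearrangement mu g) = rearrangement mu g.
Proof.
move=> Lg; apply/funext => t; rewrite -[LHS]/(inf _) -[RHS]/(inf _); congr inf.
by apply/seteqP; split => l [l0 dl]; split => //; move: dl;
  rewrite dist_fun_rearrangement// ltW.
Qed.

(** Extension by 0 turns an integral over []0, s[] into a mass on the whole line, where distribution
    functions can be compared. *)
Let truncated g s t := rearrangement mu g t * \1_(`]0%R, s[ : set R) t.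

Let measurable_truncated g s : L0mu mu g ->
  measurable_fun [set: measurableTypeR R] (truncated g s).
Proof.
move=> Lg; apply: measurable_funM; first exact: measurable_rearrangement.
by apply: measurable_indic; exact: measurable_itv.
Qed.

Let dist_truncated_le g s l : L0mu mu g -> 0 <= l ->
  (dist_fun (@lebesgue_measure R) (truncated g s) l <= dist_fun mu g l)%E.
Proof.
move=> Lg l0; rewrite -[leRHS](initial (measure_ge0 _ _)).2.
have [mI _] := initial (measure_ge0 mu [set x | l < `|g x|]).
apply: le_measure; rewrite ?inE//.
  by apply: measurable_norm_gt; exact: measurable_truncated.
rewrite -superlevel// => t /=; rewrite /truncated indicE.
have [ts|ts] := boolP (t \in (`]0%R, s[%classic : set R)); last first.
  by rewrite mulr0 normr0 ltNge l0.
rewrite mulr1 ger0_norm ?rearrangement_ge0//; move: ts; rewrite inE/= !in_itv/=.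
by move=> /andP[-> _].
Qed.

(** By monotonicity the rearrangement exceeds such a level only before [s], so the truncation loses
    nothing. *)
Let dist_truncated_ge g s l : L0mu mu g -> 0 < s -> rearrangement mu g s <= l ->
  (dist_fun mu g l <= dist_fun (@lebesgue_measure R) (truncated g s) l)%E.
Proof.
move=> Lg s0 sl; have l0 : 0 <= l := le_trans (rearrangement_ge0 g s) sl.
rewrite -[leLHS](initial (measure_ge0 _ _)).2.
have [mI _] := initial (measure_ge0 mu [set x | l < `|g x|]).
apply: le_measure; rewrite ?inE//.
  by apply: measurable_norm_gt; exact: measurable_truncated.
rewrite -superlevel// => t /= [lt]; rewrite in_itv/= andbT => t0.
rewrite /truncated indicE mem_set ?mulr1 ?ger0_norm ?rearrangement_ge0//=.
rewrite in_itv/= t0/= ltNge; apply/negP => st.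
have := rearrangement_nonincreasing Lg s0 st.
by move=> /le_trans /(_ sl); rewrite leNgt lt.
Qed.

Let mass_truncated g s l : L0mu mu g -> 0 <= l ->
  mass (@lebesgue_measure R) (excess l \o truncated g s) =
  (\int[lebesgue_measure]_(t in `]0%R, s[) (`|excess l (rearrangement mu g t)|)%:E)%E.
Proof.
move=> Lg l0; rewrite [RHS]integral_mkcond /mass; apply: eq_integral => t _.
rewrite patchE /= /truncated indicE; case: ifPn => ts; first by rewrite mulr1.
by rewrite mulr0 norm_excess// normr0 sub0r max_r// oppr_le0.
Qed.

Let integral_cst_itv (c s : R) : 0 < s ->
  (\int[lebesgue_measure]_(t in `]0%R, s[) c%:E = (c * s)%:E)%E.
Proof.
move=> s0; transitivity (c%:E * lebesgue_measure (`]0%R, s[%classic : set R))%E.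
  by apply: integral_cst; exact: measurable_itv.
by rewrite lebesgue_measure_itv/= lte_fin s0 oppr0 adde0 EFinM.
Qed.

(** Integrate g* <= l + (g* - l)^+ over []0, s[]; truncation only lowers the distribution
    function. *)
Lemma integral_rearrangement_le g s l : L0mu mu g -> 0 < s -> 0 <= l ->
  (dist_fun mu g l < +oo)%E ->
  (\int[lebesgue_measure]_(t in `]0%R, s[) (rearrangement mu g t)%:E <=
   (l * s)%:E + mass mu (excess l \o g))%E.
Proof.
move=> Lg s0 l0 fin.
have mr := measurable_rearrangement Lg.
have mI : measurable (`]0%R, s[%classic : set (measurableTypeR R)) := measurable_itv _.
have mE : measurable_fun [set: measurableTypeR R]
    (fun t => (`|excess l (rearrangement mu g t)|)%:E).
  exact/measurable_norm_EFin/measurable_fun_excess.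
apply: (@le_trans _ _ (\int[lebesgue_measure]_(t in `]0%R, s[)
    (l%:E + (`|excess l (rearrangement mu g t)|)%:E))%E).
  apply: ge0_le_integral => //.
  - by move=> t _; rewrite lee_fin rearrangement_ge0.
  - by apply: measurable_funTS; exact/measurable_EFinP.
  - by apply: measurable_funTS; exact: emeasurable_funD.
  move=> t _; rewrite -EFinD lee_fin norm_excess// ger0_norm ?rearrangement_ge0//.
  by rewrite -lerBlDl le_max lexx.
rewrite ge0_integralD//; last exact: measurable_funTS.
rewrite integral_cst_itv//; apply: leeD => //; rewrite -mass_truncated//.
apply: le_mass_excess_dist => //; [exact: measurable_truncated|exact: Lg.1|].
by move=> l' ll'; apply: dist_truncated_le => //; exact: le_trans ll'.
Qed.

(* There is equality for [eta = 0]; [eta > 0] keeps the level positive. *)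
Lemma integral_rearrangement_ge g s eta : L0mu mu g -> 0 < s -> 0 < eta ->
  (((rearrangement mu g s + eta) * s)%:E +
   mass mu (excess (rearrangement mu g s + eta) \o g) <=
   \int[lebesgue_measure]_(t in `]0%R, s[) (rearrangement mu g t)%:E +
   (eta * s)%:E)%E.
Proof.
move=> Lg s0 eta0; set l := rearrangement mu g s + eta.
have l0 : 0 <= l by rewrite addr_ge0 ?rearrangement_ge0// ltW.
have mr := measurable_rearrangement Lg.
have mI : measurable (`]0%R, s[%classic : set (measurableTypeR R)) := measurable_itv _.
have mE : measurable_fun [set: measurableTypeR R]
    (fun t => (`|excess l (rearrangement mu g t)|)%:E).
  exact/measurable_norm_EFin/measurable_fun_excess.
have sl : rearrangement mu g s <= l by rewrite lerDl ltW.
apply: (@le_trans _ _ (\int[lebesgue_measure]_(t in `]0%R, s[)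
    (l%:E + (`|excess l (rearrangement mu g t)|)%:E))%E).
  rewrite ge0_integralD//; last exact: measurable_funTS.
  rewrite integral_cst_itv//; apply: leeD => //; rewrite -mass_truncated//.
  apply: le_mass_excess_dist => //.
  - exact: Lg.1.
  - exact: measurable_truncated.
  - apply: le_lt_trans (dist_truncated_le s Lg l0) _.
    apply: (@le_lt_trans _ _ s%:E); last exact: ltry.
    by rewrite leNgt -lt_rearrangement// -leNgt.
  by move=> l' ll'; apply: dist_truncated_ge => //; exact: le_trans ll'.
rewrite -integral_cst_itv// -ge0_integralD//; last 3 first.
- by move=> t _; rewrite lee_fin rearrangement_ge0.
- by apply: measurable_funTS; exact/measurable_EFinP.
- by move=> t _; rewrite lee_fin ltW.
apply: ge0_le_integral => //.
- by move=> t _; rewrite -EFinD lee_fin addr_ge0.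
- by apply: measurable_funTS; exact: emeasurable_funD.
- by apply: measurable_funTS; apply: emeasurable_funD => //; exact/measurable_EFinP.
(* Before [s] the rearrangement is at least [l - eta], so its maximum with [l] exceeds it by at most
   [eta]. *)
move=> t /=; rewrite in_itv/= => /andP[t0 ts].
have := rearrangement_nonincreasing Lg t0 (ltW ts).
rewrite -!EFinD lee_fin norm_excess// ger0_norm ?rearrangement_ge0// /l => rst.
by rewrite /Num.max; case: ltP => ?; lra.
Qed.

Lemma Rmu_L0mu g : Rmu mu g -> L0mu mu g.
Proof.
by move=> [Lg fin]; split; [exact: L1Linfty_measurable Lg|exists 1 => //; exact: fin].
Qed.

(** The level [f*(s) + eta] is optimal for [f] up to [eta * s], while every positive level gives an
    upper bound for [g]. *)
Lemma le_integral_rearrangement f g s : L0mu mu f -> Rmu mu g ->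
  (forall l, 0 < l -> (mass mu (excess l \o g) <= mass mu (excess l \o f))%E) ->
  0 < s ->
  (\int[lebesgue_measure]_(t in `]0%R, s[) (rearrangement mu g t)%:E <=
   \int[lebesgue_measure]_(t in `]0%R, s[) (rearrangement mu f t)%:E)%E.
Proof.
move=> Lf rg le_gf s0; have Lg := Rmu_L0mu rg.
apply/lee_addgt0Pr => e e0; pose eta := e / s.
have eta0 : 0 < eta by rewrite divr_gt0.
have l0 : 0 < rearrangement mu f s + eta by rewrite ltr_wpDl ?rearrangement_ge0.
apply: le_trans (integral_rearrangement_le Lg s0 (ltW l0) (rg.2 _ l0)) _.
have -> : e = eta * s by rewrite /eta divfK// gt_eqF.
by apply: le_trans (integral_rearrangement_ge Lf s0 eta0); rewrite leeD2l// le_gf.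
Qed.

End rearrangement.

(** * Fully symmetric spaces *)

Section fully_symmetric.
Context (d : measure_display) (Omega : measurableType d) (R : realType).
Variable mu : {measure set Omega -> \bar R}.
Variables (X0 : set (R -> R)) (N0 : (R -> R) -> R).
Hypothesis fs0 : fully_symmetric_half_line X0 N0.
Implicit Types (f g : Omega -> R) (s : R).

(* Otherwise [f*] would majorize every function, and by homogeneity all norms
   would vanish. *)
Lemma fully_symmetric_integral_lty f s : L0mu mu f ->
  X0 (rearrangement mu f) -> 0 < s ->
  (\int[lebesgue_measure]_(t in `]0%R, s[) (rearrangement mu f t)%:E < +oo)%E.
Proof.
move=> Lf Xf s0; rewrite ltey; apply/eqP => is_oo.
(* Divergence can occur only at 0: a finite integral over one interval makes some excess integrable,
   which makes the integral over every interval finite. *)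
have all_oo s' : 0 < s' ->
    (\int[lebesgue_measure]_(t in `]0%R, s'[) (rearrangement mu f t)%:E = +oo)%E.
  move=> s'0; apply/eqP; apply: contraT; rewrite -ltey => fin.
  pose l := rearrangement mu f s' + 1.
  have l0 : 0 <= l by rewrite addr_ge0 ?rearrangement_ge0.
  have : (mass mu (excess l \o f) < +oo)%E.
    have := integral_rearrangement_ge Lf s'0 (ltr01 : 0 < 1 :> R).
    rewrite -/l => le; apply: (@le_lt_trans _ _ ((l * s')%:E + mass mu (excess l \o f))%E).
      by rewrite leeDr// lee_fin mulr_ge0// ltW.
    by apply: (le_lt_trans le); rewrite lte_add_pinfty// ltry.
  have dl : (dist_fun mu f l < +oo)%E.
    apply: (@le_lt_trans _ _ s'%:E); last exact: ltry.
    by rewrite leNgt -lt_rearrangement// -leNgt lerDl.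
  move=> ml; have := integral_rearrangement_le Lf s0 l0 dl.
  rewrite is_oo leye_eq => /eqP E; have : ((l * s)%:E + mass mu (excess l \o f) < +oo)%E.
    by rewrite lte_add_pinfty// ltry.
  by rewrite E ltxx.
have Lr := L0mu_rearrangement Lf.
have major (g : R -> R) : L0mu (@nu R) g -> X0 g /\ N0 g <= N0 (rearrangement mu f).
  move=> Lg; apply: (fs_major fs0) => // s' s'0.
  by rewrite rearrangementK// all_oo// leey.
have bn := fs_banach fs0.
(* Twice the rearrangement is majorized by the rearrangement itself, so [2 * N0 <= N0]. *)
have N00 : N0 (rearrangement mu f) = 0.
  have [_] := major _ (fs_sub_L0 fs0 (fsub_Z (fs_subspace fs0) 2 Xf)).
  rewrite (bnormZ bn)// ger0_norm//; have := bnorm_ge0 bn Xf; lra.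
have [h Xh h0] := fs_neq0 fs0; apply: h0; apply/(bnorm_eq0 bn Xh).
have [_] := major _ (fs_sub_L0 fs0 Xh).
by rewrite N00 => h0; apply/eqP; rewrite eq_le h0 (bnorm_ge0 bn Xh).
Qed.

Lemma L0mu_cst1 : L0mu mu (cst 1).
Proof.
split => //; exists 1 => //; rewrite /dist_fun (_ : [set x | _] = set0) ?measure0//.
by apply/seteqP; split => // x /=; rewrite normr1 ltxx.
Qed.

(* If [|f| > l] on a set of infinite measure, then [f*] dominates the constant
   [l]. *)
Lemma fully_symmetric_Rmu f : ~ X0 (rearrangement mu (cst 1)) ->
  L0mu mu f -> X0 (rearrangement mu f) -> Rmu mu f.
Proof.
move=> X1 Lf Xf.
split.
  (* Finiteness of the integral over []0, 1[] makes the excess over [f*(1) + 1] integrable; the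
     clipped part is bounded. *)
  have := integral_rearrangement_ge Lf ltr01 (ltr01 : 0 < 1 :> R).
  set l := rearrangement mu f 1 + 1 => le.
  have l0 : 0 <= l by rewrite addr_ge0 ?rearrangement_ge0.
  apply: (@L1Linfty_excess _ _ _ _ _ l) => //; first exact: Lf.1.
  apply: (@le_lt_trans _ _ ((l * 1)%:E + mass mu (excess l \o f))%E).
    by rewrite leeDr// lee_fin mulr_ge0.
  apply: (le_lt_trans le); rewrite lte_add_pinfty ?ltry//.
  exact: fully_symmetric_integral_lty.
move=> l l0; rewrite ltey; apply/eqP => doo; apply: X1.
have L1 := L0mu_cst1.
have Lr := L0mu_rearrangement Lf.
(* Rescaling turns domination of the constant [l] into domination of 1. *)
have Xl := fsub_Z (fs_subspace fs0) l^-1 Xf.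
have Ll := fs_sub_L0 fs0 Xl.
apply: (proj1 (fs_major fs0 Xl (L0mu_rearrangement L1) _)) => s s0.
rewrite rearrangementK//; apply: ge0_le_integral => //.
- by move=> t _; rewrite lee_fin rearrangement_ge0.
- apply: measurable_funTS; apply/measurable_EFinP; exact: measurable_rearrangement.
- apply: measurable_funTS; apply/measurable_EFinP; exact: measurable_rearrangement.
move=> t /=; rewrite in_itv/= => /andP[t0 _]; rewrite lee_fin.
apply: (@le_trans _ _ 1).
  apply: rearrangement_le => //; rewrite /dist_fun (_ : [set x | _] = set0).
    by rewrite measure0 lee_fin ltW.
  by apply/seteqP; split => // x /=; rewrite normr1 ltxx.
rewrite leNgt; apply/negP => lt1.
set k := rearrangement _ _ t in lt1.
(* As [k < 1], the superlevel set at [k] contains [{f* > l}], of infinite measure;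
   [lt_rearrangement] then yields [k < k]. *)
have : (t%:E < dist_fun (@nu R) (l^-1 \*o rearrangement mu f) k)%E.
  apply: (@lt_le_trans _ _ +oo%E); first exact: ltry.
  rewrite -doo -(dist_fun_rearrangement Lf (ltW l0)).
  apply: le_measure; rewrite ?inE.
  - by apply: measurable_norm_gt; exact: Lr.1.
  - by apply: measurable_norm_gt; exact: Ll.1.
  move=> x lx; change (k < `|l^-1 * rearrangement mu f x|).
  have {}lx : l < `|rearrangement mu f x| by [].
  rewrite normrM ger0_norm ?invr_ge0 ?(ltW l0)//.
  by apply: (lt_trans lt1); rewrite mulrC ltr_pdivlMr// mul1r.
by rewrite -lt_rearrangement ?rearrangement_ge0// ltxx.
Qed.

End fully_symmetric.

Theorem theorem3p1 (d : measure_display) (Omega : measurableType d)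
    (R : realType) (mu : {measure set Omega -> \bar R}) :
  (forall (X : set (Omega -> R)) (N : (Omega -> R) -> R),
     fully_symmetric_space mu X N ->
     ~ X (cst 1) ->
     forall (T : (Omega -> R) -> (Omega -> R)) (f : Omega -> R),
       dunford_schwartz mu T -> X f ->
       exists fhat : Omega -> R,
         X fhat /\ cvg_au mu (fun n => ergodic_average T n f) fhat)
  /\
  (forall (T : (Omega -> R) -> (Omega -> R)) (f : Omega -> R),
     dunford_schwartz mu T -> Rmu mu f ->
     exists fhat : Omega -> R,
       Rmu mu fhat /\ cvg_au mu (fun n => ergodic_average T n f) fhat).
Proof.
split=> [X N [X0 [N0 [fs0 -> _]]] X1 T f dsT [Lf Xf]|T f dsT rf]; last first.
  by have [fhat [? ? _]] := Rmu_average_cvg dsT rf; exists fhat.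
have X01 : ~ X0 (rearrangement mu (cst 1)).
  by move=> X01; apply: X1; split => //; exact: L0mu_cst1.
have [fhat [rfh au le]] := Rmu_average_cvg dsT (fully_symmetric_Rmu fs0 X01 Lf Xf).
have Lfh := Rmu_L0mu rfh.
exists fhat; split => //; split => //.
apply: (proj1 (fs_major fs0 Xf (L0mu_rearrangement Lfh) _)) => s s0.
by rewrite !rearrangementK//; exact: le_integral_rearrangement.
Qed.
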